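(* Let $k$ be an algebraically closed field of characteristic zero, let $X$ be a connected normal algebraic variety over $k$, and let $\pi:E\to X$ be a vector bundle on $X$. Let $F$ be a closed subvariety of $E$ such that the fibres $F_x = F\cap E_x$ (where $E_x=\pi^{-1}(x)$) are vector subspaces of $E_x$ of constant dimension for all $x\in X$. Then $F$ is a sub-bundle of $E$.
   Context: Varieties over the algebraically closed field $k$ are reduced and not necessarily irreducible; points $x\in X$ mean closed points. A closed subvariety is a closed subset with its reduced structure. A vector bundle of rank $n$ on $X$ is a variety $E$ equipped with a morphism $\pi:E\to X$ and the structure of an $n$-dimensional $k$-vector space on each fibre $E_x=\pi^{-1}(x)$, such that each $x\in X$ has an open neighbourhood $U$ for which there is an isomorphism $\phi:\pi^{-1}(U)\to U\times k^n$ with $p\circ\phi=\pi$ on $\pi^{-1}(U)$ (where $p:U\times k^n\to U$ is the projection) and with $\phi$ inducing linear maps on the fibres over $U$. A sub-bundle of $E$ is a closed subvariety $F$ of $E$ whose fibres $F_x=F\cap E_x$ are vector subspaces of $E_x$ for all $x\in X$, and such that $F$, equipped with $\pi|_F:F\to X$ and the induced vector space structures on its fibres, is locally trivial, meaning that each $x\in X$ has an open neighbourhood $U$ for which there are an integer $d\ge 0$ and an isomorphism $\psi:(\pi|_F)^{-1}(U)\to U\times k^d$ with $q\circ\psi=\pi|_F$ on $(\pi|_F)^{-1}(U)$ (where $q:U\times k^d\to U$ is the projection) and with $\psi$ inducing linear maps on the fibres over $U$; hence $F$ is a vector bundle. The hypothesis that the $F_x$ are vector subspaces of constant dimension concerns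 only the underlying sets of points. *)

(* Defs.v *)
(* MathComp, with the sets and topology of MathComp-Analysis. *)
From HB Require Import structures.
From mathcomp Require Import all_boot all_order all_algebra.
From mathcomp Require Import all_classical topology.
From mathcomp Require Import -(notations) mpoly.

Set Implicit Arguments.
Unset Strict Implicit.
Unset Printing Implicit Defensive.

Import GRing.Theory.

Local Open Scope classical_set_scope.
Local Open Scope ring_scope.

(* Varieties are treated in the language of spaces with functions: topological
   spaces endowed with a sheaf of k-valued functions. The sheaf is given by the
   predicate [regular_at x f], "f is regular on some neighbourhood of x"; it
   only depends on the germ of f at x, and the sections over an open set U are
   the functions on U that are regular at every point of U, however they are
   extended outside U. With this encoding the sheaf axiom holds by
   construction. *)
Record fun_space (k : fieldType) := Space {
  space_carrier :> topologicalType;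
  regular_at : space_carrier -> (space_carrier -> k) -> Prop;
  regular_germ : forall x f g, (\forall y \near x, f y = g y) ->
    regular_at x f -> regular_at x g;
  regular_near : forall x f, regular_at x f ->
    \forall y \near x, regular_at y f;
  regular_cst : forall x c, regular_at x (fun=> c);
  regularD : forall x f g, regular_at x f -> regular_at x g ->
    regular_at x (fun y => f y + g y);
  regularM : forall x f g, regular_at x f -> regular_at x g ->
    regular_at x (fun y => f y * g y);
  regular_neq0 : forall x f, regular_at x f -> f x != 0 ->
    \forall y \near x, f y != 0;
  regularV : forall x f, regular_at x f -> f x != 0 ->
    regular_at x (fun y => (f y)^-1)
}.

Section Morphisms.
Context (k : fieldType).

Definition morphism (X Y : fun_space k) (f : X -> Y) : Prop :=
  continuous f /\
  forall x g, @regular_at k Y (f x) g -> @regular_at k X x (g \o f).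

Definition isomorphism (X Y : fun_space k) (f : X -> Y) : Prop :=
  morphism f /\ exists g : Y -> X, [/\ cancel f g, cancel g f & morphism g].

End Morphisms.

(* The structure induced on a subset A: the regular functions are those that
   extend locally to regular functions on the ambient space. For A open this is
   the restricted sheaf, and for A a closed subset of a variety it is the
   reduced structure. *)
Section Induced.
Context (k : fieldType) (X : fun_space k) (A : set X).

Definition induced_regular (a : set_type A) (f : set_type A -> k) : Prop :=
  exists2 g : X -> k, regular_at (set_val a) g &
    \forall b \near a, f b = g (set_val b).

Lemma near_induced (a : set_type A) (P : set X) :
  nbhs (set_val a) P -> \forall b \near a, P (set_val b).
Proof. exact: (@initial_continuous (set_type A) X set_val a). Qed.

Fact induced_germ a f g : (\forall b \near a, f b = g b) ->
  induced_regular a f -> induced_regular a g.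
Proof.
move=> fg [h hr fh]; exists h => //.
by near=> b; rewrite -(near fg b)//; near: b.
Unshelve. all: by end_near. Qed.

Fact induced_near a f : induced_regular a f ->
  \forall b \near a, induced_regular b f.
Proof.
move=> [h hr fh]; near=> b; exists h.
  near: b; apply: (@near_induced a (fun y => regular_at y h)).
  exact: regular_near.
by near: b; exact: (near_join fh).
Unshelve. all: by end_near. Qed.

Fact induced_cst a c : induced_regular a (fun=> c).
Proof. by exists (fun=> c); [exact: regular_cst|near=> b].
Unshelve. all: by end_near. Qed.

Fact inducedD a f g : induced_regular a f -> induced_regular a g ->
  induced_regular a (fun b => f b + g b).
Proof.
move=> [f' f'r ff'] [g' g'r gg']; exists (fun y => f' y + g' y).
  exact: regularD.
by near=> b; congr (_ + _); near: b.
Unshelve. all: by end_near. Qed.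

Fact inducedM a f g : induced_regular a f -> induced_regular a g ->
  induced_regular a (fun b => f b * g b).
Proof.
move=> [f' f'r ff'] [g' g'r gg']; exists (fun y => f' y * g' y).
  exact: regularM.
by near=> b; congr (_ * _); near: b.
Unshelve. all: by end_near. Qed.

Fact induced_neq0 a f : induced_regular a f -> f a != 0 ->
  \forall b \near a, f b != 0.
Proof.
move=> [g gr fg] fa; have ga : g (set_val a) != 0.
  by rewrite -(nbhs_singleton fg).
near=> b; rewrite (near fg b)//.
by near: b; apply: (@near_induced a (fun y => g y != 0)); exact: regular_neq0.
Unshelve. all: by end_near. Qed.

Fact inducedV a f : induced_regular a f -> f a != 0 ->
  induced_regular a (fun b => (f b)^-1).
Proof.
move=> [g gr fg] fa; exists (fun y => (g y)^-1).
  by apply: regularV => //; rewrite -(nbhs_singleton fg).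
by near=> b; congr (_ ^-1); near: b.
Unshelve. all: by end_near. Qed.

Definition induced_space : fun_space k :=
  @Space k (set_type A) induced_regular induced_germ induced_near induced_cst
    inducedD inducedM induced_neq0 inducedV.

End Induced.

(* Affine space k^n with its Zariski topology, whose basic open sets are the
   nonvanishing loci of polynomials, and the sheaf of regular functions. *)
Section AffineSpace.
Context (k : fieldType) (n : nat).

Definition affine_carrier : Type := 'rV[k]_n.
HB.instance Definition _ := Choice.on affine_carrier.

Definition peval (p : mpoly n k) (v : 'rV[k]_n) : k :=
  meval (fun i => v ord0 i) p.

Definition affine_open : set_system affine_carrier :=
  [set U | forall v, U v -> exists2 p, peval p v != 0 &
    forall w, peval p w != 0 -> U w].

Fact affine_openT : affine_open setT.
Proof.
by move=> v _; exists (mpolyC n 1) => //; rewrite /peval mevalC oner_eq0.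
Qed.

Fact affine_openI : setI_closed affine_open.
Proof.
move=> U V oU oV v [/oU[p pv pU] /oV[q qv qV]]; exists (p * q).
  by rewrite /peval mevalM mulf_neq0.
move=> w; rewrite /peval mevalM mulf_eq0 negb_or => /andP[pw qw].
by split; [exact: pU|exact: qV].
Qed.

Fact affine_open_bigU (I : Type) (U : I -> set affine_carrier) :
  (forall i, affine_open (U i)) -> affine_open (\bigcup_i U i).
Proof.
move=> oU v [i _ /oU[p pv pU]]; exists p => // w /pU Uw; by exists i.
Qed.

HB.instance Definition _ := isOpenTopological.Build affine_carrier
  affine_openT affine_openI affine_open_bigU.

Definition affine_regular (v : affine_carrier) (f : affine_carrier -> k) :=
  exists p q, peval q v != 0 /\ \forall w \near v, f w = peval p w / peval q w.

Lemma peval_neq0 p (v : affine_carrier) : peval p v != 0 ->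
  \forall w \near v, peval p w != 0.
Proof.
move=> pv; exists [set w | peval p w != 0]; split=> //.
by move=> w /= pw; exists p.
Qed.

Fact affine_germ v f g : (\forall w \near v, f w = g w) ->
  affine_regular v f -> affine_regular v g.
Proof.
move=> fg [p [q [qv fpq]]]; exists p, q; split=> //.
by near=> w; rewrite -(near fg w)//; near: w.
Unshelve. all: by end_near. Qed.

Fact affine_near v f : affine_regular v f ->
  \forall w \near v, affine_regular w f.
Proof.
move=> [p [q [qv fpq]]]; near=> w; exists p, q; split.
  by near: w; exact: peval_neq0.
by near: w; exact: (near_join fpq).
Unshelve. all: by end_near. Qed.

Fact affine_cst v c : affine_regular v (fun=> c).
Proof.
exists (mpolyC n c), (mpolyC n 1).
rewrite /peval mevalC oner_eq0; split=> //.
by near=> w; rewrite !mevalC divr1.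
Unshelve. all: by end_near. Qed.

Fact affineD v f g : affine_regular v f -> affine_regular v g ->
  affine_regular v (fun w => f w + g w).
Proof.
move=> [p [q [qv fE]]] [p' [q' [q'v gE]]].
exists (p * q' + p' * q), (q * q').
split; first by rewrite /peval mevalM mulf_neq0.
near=> w; rewrite (near fE w)// (near gE w)// addf_div.
- by rewrite /peval mevalD !mevalM.
- by near: w; exact: peval_neq0.
- by near: w; exact: peval_neq0.
Unshelve. all: by end_near. Qed.

Fact affineM v f g : affine_regular v f -> affine_regular v g ->
  affine_regular v (fun w => f w * g w).
Proof.
move=> [p [q [qv fE]]] [p' [q' [q'v gE]]]; exists (p * p'), (q * q').
split; first by rewrite /peval mevalM mulf_neq0.
near=> w; rewrite (near fE w)// (near gE w)// mulf_div.
by rewrite /peval !mevalM.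
Unshelve. all: by end_near. Qed.

Fact affine_neq0 v f : affine_regular v f -> f v != 0 ->
  \forall w \near v, f w != 0.
Proof.
move=> [p [q [qv fE]]]; rewrite (nbhs_singleton fE) => pqv.
near=> w; rewrite (near fE w)// mulf_neq0 ?invr_eq0//.
- near: w; apply: peval_neq0; apply: contra_neq pqv => ->; exact: mul0r.
- by near: w; exact: peval_neq0.
Unshelve. all: by end_near. Qed.

Fact affineV v f : affine_regular v f -> f v != 0 ->
  affine_regular v (fun w => (f w)^-1).
Proof.
move=> [p [q [qv fE]]]; rewrite (nbhs_singleton fE) => pqv; exists q, p.
split; first by apply: contra_neq pqv => ->; exact: mul0r.
by near=> w; rewrite (near fE w)// invf_div.
Unshelve. all: by end_near. Qed.

Definition affine_space : fun_space k :=
  @Space k affine_carrier affine_regular affine_germ affine_near affine_cst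
    affineD affineM affine_neq0 affineV.

End AffineSpace.

(* The product of two spaces with functions. Its topology is in general finer
   than the product topology: the basic open sets are the nonvanishing loci, in
   products of open sets, of the functions sum_i f_i(x) g_i(y) with f_i and g_i
   regular; the regular functions are locally quotients of such functions. *)
Section Product.
Context (k : fieldType) (X Y : fun_space k).

Definition product_carrier : Type := (X * Y)%type.
HB.instance Definition _ := Choice.on product_carrier.

Definition tensor_at (z : X * Y) (h : X * Y -> k) : Prop :=
  exists (I : finType) (f : I -> X -> k) (g : I -> Y -> k),
    [/\ forall i, regular_at z.1 (f i), forall i, regular_at z.2 (g i) &
        forall t, h t = \sum_i f i t.1 * g i t.2].

Definition product_open : set_system product_carrier :=
  [set W | forall z, W z -> exists h, [/\ tensor_at z h, h z != 0 &
    exists U V, [/\ nbhs z.1 U, nbhs z.2 V &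
      forall t, U t.1 -> V t.2 -> h t != 0 -> W t]]].

Lemma tensor_cst z c : tensor_at z (fun=> c).
Proof.
exists unit, (fun _ _ => c), (fun _ _ => 1); split.
- by move=> _; exact: regular_cst.
- by move=> _; exact: regular_cst.
- by move=> t; rewrite big_const cardT enumT unlock /= mulr1 addr0.
Qed.

Lemma tensorD z h h' : tensor_at z h -> tensor_at z h' ->
  tensor_at z (fun t => h t + h' t).
Proof.
move=> [I [f [g [fr gr hE]]]] [J [f' [g' [f'r g'r h'E]]]].
exists (I + J)%type, (fun s => match s with inl i => f i | inr j => f' j end),
  (fun s => match s with inl i => g i | inr j => g' j end).
by split=> [[]//|[]//|t]; rewrite hE h'E big_sumType.
Qed.

Lemma tensorM z h h' : tensor_at z h -> tensor_at z h' ->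
  tensor_at z (fun t => h t * h' t).
Proof.
move=> [I [f [g [fr gr hE]]]] [J [f' [g' [f'r g'r h'E]]]].
exists (I * J)%type, (fun s x => f s.1 x * f' s.2 x),
  (fun s y => g s.1 y * g' s.2 y).
split=> [s|s|t]; [exact: regularM|exact: regularM|].
rewrite hE h'E mulr_suml -(pair_bigA _ (fun i j => f i t.1 * f' j t.1 *
  (g i t.2 * g' j t.2))) /=; apply: eq_bigr => i _.
by rewrite mulr_sumr; apply: eq_bigr => j _; rewrite mulrACA.
Qed.

Lemma tensor_near z h : tensor_at z h ->
  exists U V, [/\ nbhs z.1 U, nbhs z.2 V &
    forall t, U t.1 -> V t.2 -> tensor_at t h].
Proof.
move=> [I [f [g [fr gr hE]]]].
exists [set x | forall i, regular_at x (f i)],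
  [set y | forall i, regular_at y (g i)]; split.
- by apply: filter_forall => i; exact: regular_near.
- by apply: filter_forall => i; exact: regular_near.
- by move=> t fr' gr'; exists I, f, g.
Qed.

Fact product_openT : product_open setT.
Proof.
move=> z _; exists (fun=> 1); split; [exact: tensor_cst|exact: oner_neq0|].
by exists setT, setT; split=> //; exact: filterT.
Qed.

Fact product_openI : setI_closed product_open.
Proof.
move=> W W' oW oW' z [/oW[h [hr hz [U [V [Uz Vz UV]]]]]].
move=> /oW'[h' [h'r h'z [U' [V' [U'z V'z UV']]]]].
exists (fun t => h t * h' t); split; [exact: tensorM|exact: mulf_neq0|].
exists (U `&` U'), (V `&` V'); split; [exact: filterI|exact: filterI|].
move=> t [Ut U't] [Vt V't]; rewrite mulf_eq0 negb_or => /andP[ht h't].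
by split; [exact: UV|exact: UV'].
Qed.

Fact product_open_bigU (I : Type) (W : I -> set product_carrier) :
  (forall i, product_open (W i)) -> product_open (\bigcup_i W i).
Proof.
move=> oW z [i _ /oW[h [hr hz [U [V [Uz Vz UV]]]]]]; exists h; split=> //.
exists U, V; split=> // t Ut Vt ht; exists i => //; exact: UV.
Qed.

HB.instance Definition _ := isOpenTopological.Build product_carrier
  product_openT product_openI product_open_bigU.

Lemma near_product (z : product_carrier) (U : set X) (V : set Y) :
  nbhs z.1 U -> nbhs z.2 V -> \forall t \near z, U t.1 /\ V t.2.
Proof.
move=> Uz Vz; exists [set t | U° t.1 /\ V° t.2]; split.
- move=> t [/= Ut Vt]; exists (fun=> 1); split.
  + exact: tensor_cst.
  + exact: oner_neq0.
  + exists U°, V°; split=> //; exact: nbhs_interior.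
- by [].
- by move=> t [Ut Vt]; split; exact: nbhs_singleton.
Qed.

Lemma near_tensor (z : product_carrier) h : tensor_at z h ->
  \forall t \near z, tensor_at t h.
Proof.
move=> /tensor_near[U [V [Uz Vz UV]]].
by apply: filterS (near_product Uz Vz) => t [Ut Vt]; exact: UV.
Qed.

Lemma tensor_neq0 (z : product_carrier) h : tensor_at z h -> h z != 0 ->
  \forall t \near z, h t != 0.
Proof.
move=> hr hz; have [U [V [Uz Vz UV]]] := tensor_near hr.
exists [set t | [/\ U° t.1, V° t.2 & h t != 0]]; split=> //.
- move=> t [/= Ut Vt ht]; exists h; split=> //.
    by apply: UV; exact: nbhs_singleton.
  exists U°, V°; split=> //; exact: nbhs_interior.
- by move=> t [].
Qed.

Definition product_regular (z : product_carrier) (f : product_carrier -> k) :=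
  exists p q, [/\ tensor_at z p, tensor_at z q, q z != 0 &
    \forall t \near z, f t = p t / q t].

Fact product_germ z f g : (\forall t \near z, f t = g t) ->
  product_regular z f -> product_regular z g.
Proof.
move=> fg [p [q [pr qr qz fpq]]]; exists p, q; split=> //.
by near=> t; rewrite -(near fg t)//; near: t.
Unshelve. all: by end_near. Qed.

Fact product_near z f : product_regular z f ->
  \forall t \near z, product_regular t f.
Proof.
move=> [p [q [pr qr qz fpq]]]; near=> t; exists p, q; split.
- by near: t; exact: near_tensor.
- by near: t; exact: near_tensor.
- by near: t; exact: tensor_neq0.
- by near: t; exact: (near_join fpq).
Unshelve. all: by end_near. Qed.

Fact product_cst z c : product_regular z (fun=> c).
Proof.
exists (fun=> c), (fun=> 1); split.
- exact: tensor_cst.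
- exact: tensor_cst.
- exact: oner_neq0.
- by near=> t; rewrite divr1.
Unshelve. all: by end_near. Qed.

Fact productD z f g : product_regular z f -> product_regular z g ->
  product_regular z (fun t => f t + g t).
Proof.
move=> [p [q [pr qr qz fE]]] [p' [q' [p'r q'r q'z gE]]].
exists (fun t => p t * q' t + p' t * q t), (fun t => q t * q' t); split.
- by apply: tensorD; exact: tensorM.
- exact: tensorM.
- exact: mulf_neq0.
- near=> t; rewrite (near fE t)// (near gE t)// addf_div//.
  + by near: t; exact: tensor_neq0.
  + by near: t; exact: tensor_neq0.
Unshelve. all: by end_near. Qed.

Fact productM z f g : product_regular z f -> product_regular z g ->
  product_regular z (fun t => f t * g t).
Proof.
move=> [p [q [pr qr qz fE]]] [p' [q' [p'r q'r q'z gE]]].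
exists (fun t => p t * p' t), (fun t => q t * q' t); split.
- exact: tensorM.
- exact: tensorM.
- exact: mulf_neq0.
- by near=> t; rewrite (near fE t)// (near gE t)// mulf_div.
Unshelve. all: by end_near. Qed.

Fact product_neq0 z f : product_regular z f -> f z != 0 ->
  \forall t \near z, f t != 0.
Proof.
move=> [p [q [pr qr qz fE]]]; rewrite (nbhs_singleton fE) => pqz.
near=> t; rewrite (near fE t)// mulf_neq0 ?invr_eq0//.
- near: t; apply: tensor_neq0 => //.
  by apply: contra_neq pqz => ->; exact: mul0r.
- by near: t; exact: tensor_neq0.
Unshelve. all: by end_near. Qed.

Fact productV z f : product_regular z f -> f z != 0 ->
  product_regular z (fun t => (f t)^-1).
Proof.
move=> [p [q [pr qr qz fE]]]; rewrite (nbhs_singleton fE) => pqz; exists q, p.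
split=> //; first by apply: contra_neq pqz => ->; exact: mul0r.
by near=> t; rewrite (near fE t)// invf_div.
Unshelve. all: by end_near. Qed.

Definition product_space : fun_space k :=
  @Space k product_carrier product_regular product_germ product_near product_cst
    productD productM product_neq0 productV.

End Product.

(* A variety is a separated space with functions admitting a finite open cover
   by affine varieties; it need not be irreducible, and its points are the
   closed points of the corresponding reduced scheme. This is the classical
   notion of variety, hence only meaningful for k algebraically closed. *)
Section Varieties.
Context (k : fieldType).

Definition affine_variety (X : fun_space k) : Prop :=
  exists (n : nat) (Z : set (affine_space k n)), closed Z /\
    exists f : X -> induced_space Z, isomorphism f.

Definition separated_variety (X : fun_space k) : Prop :=
  closed [set z : product_space X X | z.1 = z.2].

Definition variety (X : fun_space k) : Prop :=
  separated_variety X /\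
  exists (I : finType) (U : I -> set X),
    [/\ forall i, open (U i), forall x, exists i, U i x &
        forall i, affine_variety (induced_space (U i))].

(* R, with the map [germ], is the ring of germs of regular functions at x; the
   values of [germ] at functions that are not regular at x are irrelevant. *)
Record local_ring_at (X : fun_space k) (x : X) (R : nzRingType) :=
    LocalRing {
  germ : (X -> k) -> R;
  germ_surj : forall r, exists2 f, regular_at x f & germ f = r;
  germ_eq : forall f g, regular_at x f -> regular_at x g ->
    germ f = germ g <-> \forall y \near x, f y = g y;
  germ1 : germ (fun=> 1) = 1;
  germD : forall f g, regular_at x f -> regular_at x g ->
    germ (fun y => f y + g y) = germ f + germ g;
  germM : forall f g, regular_at x f -> regular_at x g ->
    germ (fun y => f y * g y) = germ f * germ g
}.

Definition integrally_closed (R : idomainType) : Prop :=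
  forall u : {fraction R}, integralOver (@FracField.tofrac R) u ->
    exists r : R, u = FracField.tofrac r.

(* All local rings are integrally closed domains. *)
Definition normal_variety (X : fun_space k) : Prop :=
  forall x : X, exists (R : idomainType) (_ : local_ring_at x R),
    integrally_closed R.

End Varieties.

(* A morphism E -> X with a finite-dimensional vector space structure on each
   fibre E_x, given by a vector space [fibre x] and a bijection [fibre_in x]
   from it onto E_x. *)
Record linear_fibration (k : fieldType) (X E : fun_space k) := LinearFibration {
  bundle_proj :> E -> X;
  proj_morphism : morphism bundle_proj;
  fibre : X -> vectType k;
  fibre_in : forall x, fibre x -> E;
  fibre_in_inj : forall x, injective (@fibre_in x);
  fibre_in_range : forall x, range (@fibre_in x) = bundle_proj @^-1` [set x]
}.

Section Bundles.
Context (k : fieldType) (X : fun_space k).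

(* There is an isomorphism from the part of E above U to U x k^d, over U and
   linear on the fibres. *)
Definition trivial_over (E : fun_space k) (pi : linear_fibration X E)
    (U : set X) (d : nat) : Prop :=
  exists phi : induced_space (pi @^-1` U) ->
      product_space (induced_space U) (affine_space k d),
    [/\ isomorphism phi,
        forall e, set_val (phi e).1 = pi (set_val e) &
        forall x, U x -> exists L : {linear fibre pi x -> 'rV[k]_d},
          forall (v : fibre pi x) e, set_val e = fibre_in v ->
            (phi e).2 = L v :> 'rV[k]_d].

Definition vector_bundle (E : fun_space k) (n : nat)
    (pi : linear_fibration X E) : Prop :=
  [/\ variety E,
      forall x, \dim {: fibre pi x} = n &
      forall x, exists U, [/\ open U, U x & trivial_over pi U n]].

Context (E : fun_space k) (pi : linear_fibration X E).

(* W x is the set of points of F in the fibre E_x. *)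
Definition fibre_at (F : set E) (x : X) (W : {vspace fibre pi x}) : Prop :=
  forall v : fibre pi x, F (fibre_in v) <-> v \in W.

(* F, with the restriction of pi and the vector space structures induced on
   its fibres F_x = W x. *)
Section SubFibration.
Context (F : set E) (W : forall x, {vspace fibre pi x}).
Context (FW : forall x, fibre_at F (W x)).

Definition sub_proj (e : induced_space F) : X := pi (set_val e).

Fact sub_proj_morphism : morphism sub_proj.
Proof.
have [pic pir] := proj_morphism pi; split.
  move=> e; apply: (@continuous_comp _ _ _ set_val pi); last exact: pic.
  exact: (@initial_continuous (set_type F) E set_val).
move=> e g gr; exists (g \o pi); first exact: pir.
by near=> e'.
Unshelve. all: by end_near. Qed.

Fact sub_fib_subproof x (w : subvs_of (W x)) : fibre_in (vsval w) \in F.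
Proof. by apply/mem_set/FW; exact: subvsP. Qed.

Definition sub_fib_in x (w : subvs_of (W x)) : induced_space F :=
  SigSub (sub_fib_subproof w).

Fact sub_fib_in_inj x : injective (@sub_fib_in x).
Proof.
by move=> v w /(congr1 val)/= /fibre_in_inj vw; exact: val_inj.
Qed.

Fact sub_fib_in_range x : range (@sub_fib_in x) = sub_proj @^-1` [set x].
Proof.
have E_ := fibre_in_range pi x; apply/seteqP; split.
  by move=> _ [w _ <-]; have : (pi @^-1` [set x]) (fibre_in (vsval w))
    by rewrite -E_; exists (vsval w).
move=> e ex; have : range (@fibre_in _ _ _ pi x) (set_val e) by rewrite E_.
move=> [v _ ve]; have vW : v \in W x by apply/FW; rewrite ve; exact: set_valP.
exists (vsproj (W x) v) => //; apply: val_inj => /=.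
by rewrite vsprojK.
Qed.

Definition sub_fibration : linear_fibration X (induced_space F) :=
  @LinearFibration k X (induced_space F) sub_proj sub_proj_morphism
    (fun x => subvs_of (W x)) sub_fib_in sub_fib_in_inj sub_fib_in_range.

End SubFibration.

Definition sub_bundle (F : set E) : Prop :=
  closed F /\
  exists (W : forall x, {vspace fibre pi x}) (FW : forall x, fibre_at F (W x)),
    forall x, exists (U : set X) (d : nat),
      [/\ open U, U x & trivial_over (sub_fibration FW) U d].

End Bundles.

(* Main.v *)
(* Near a point x0 of X, where E is X x k^n, choose a complement C of F_x0. The
   sets F + C' with C' a subspace of C are again closed, by elimination of one
   variable at a time (resultants), so C remains a complement of F_x near x0.
   Let c be a vector of a basis of C and C' the span of the others: the
   coordinate a(x) of a vector w on c, along F_x + C', is the function such that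
   w - a(x) c is in F_x + C'. Its graph is closed and it is a root of a polynomial
   over the ring of functions with leading coefficient not vanishing at x0. Such
   a function is regular: in characteristic 0 its polynomial S of minimal degree
   is separable, so that over a general point S has deg S roots, all on the
   graph; hence deg S = 1 and a is a rational function, which is regular as it is
   integral over the local ring of the normal variety X. The projection onto C
   along F_x thus depends regularly on x, and the complementary projections
   trivialise F. *)
Require Import Defs.
From HB Require Import structures.
From mathcomp Require Import all_boot all_order all_algebra ring separable.
From mathcomp Require Import all_classical topology.
From mathcomp Require Import -(notations) mpoly.
Set Implicit Arguments.
Unset Strict Implicit.
Unset Printing Implicit Defensive.
Import GRing.Theory.
Local Open Scope classical_set_scope.
Local Open Scope ring_scope.

(** * Hilbert's basis theorem *)

Section Noetherian.

Definition ideal_pred (R : comNzRingType) (J : R -> Prop) : Prop :=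
  [/\ J 0, forall a b, J a -> J b -> J (a + b) & forall c a, J a -> J (c * a)].

(** The ideal generated by I, as the intersection of the ideals containing it: an induction
    principle takes the place of linear combinations. *)
Definition gen_ideal (R : comNzRingType) (I : R -> Prop) (a : R) : Prop :=
  forall J, ideal_pred J -> (forall b, I b -> J b) -> J a.

(** I is any subset and the generators are chosen in I itself, so that the definition applies
    directly to the values of a sequence. *)
Definition noetherian (R : comNzRingType) : Prop :=
  forall I : R -> Prop, exists s : seq R,
    (forall a, a \in s -> I a) /\ forall a, I a -> gen_ideal (fun b => b \in s) a.

Lemma gen_ideal_ideal (R : comNzRingType) (I : R -> Prop) :
  ideal_pred (gen_ideal I).
Proof.
split=> [J [] //|a b aI bI J JI IJ|c a aI J JI IJ]; have [_ JD JM] := JI.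
  by apply: JD; [exact: aI|exact: bI].
by apply: JM; exact: aI.
Qed.

Lemma gen_ideal_in (R : comNzRingType) (I : R -> Prop) a : I a -> gen_ideal I a.
Proof. by move=> Ia J _; exact. Qed.

Lemma gen_ideal_trans (R : comNzRingType) (I I' : R -> Prop) :
  (forall a, I a -> gen_ideal I' a) -> forall a, gen_ideal I a -> gen_ideal I' a.
Proof. by move=> II' a; apply => //; exact: gen_ideal_ideal. Qed.

(** The elements lying in the ideal of some finite part of I form an ideal that contains I. *)
Lemma gen_ideal_seq (R : comNzRingType) (I : R -> Prop) a : gen_ideal I a ->
  exists s : seq R, (forall b, b \in s -> I b) /\ gen_ideal (fun b => b \in s) a.
Proof.
move=> aI; apply: (aI (fun a => exists s : seq R,
  (forall b, b \in s -> I b) /\ gen_ideal (fun b => b \in s) a)); last first.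
  move=> b Ib; exists [:: b]; split; first by move=> c /[!inE]/eqP ->.
  by apply: gen_ideal_in; rewrite /= inE.
split.
- by exists [::]; split=> // J [].
- move=> b c [s [sI sb]] [t [tI tc]]; exists (s ++ t); split.
    by move=> d; rewrite mem_cat => /orP[/sI|/tI].
  have [_ D _] := gen_ideal_ideal (fun b => b \in s ++ t); apply: D.
    apply: gen_ideal_trans sb => d ds.
    by apply: gen_ideal_in; rewrite mem_cat (ds : d \in s).
  apply: gen_ideal_trans tc => d ds.
  by apply: gen_ideal_in; rewrite mem_cat (ds : d \in t) orbT.
- move=> c b [s [sI sb]]; exists s; split=> //.
  by have [_ _ M] := gen_ideal_ideal (fun b => b \in s); exact: M.
Qed.

Lemma gen_ideal_seqs (R : comNzRingType) (I : R -> Prop) (t : seq R) :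
  (forall b, b \in t -> gen_ideal I b) ->
  exists s : seq R, (forall b, b \in s -> I b) /\
    forall b, b \in t -> gen_ideal (fun b => b \in s) b.
Proof.
elim: t => [|b t IH] tI; first by exists [::].
have [|s [sI st]] := IH; first by move=> c ct; apply: tI; rewrite inE ct orbT.
have [|r [rI rb]] := @gen_ideal_seq _ I b; first by apply: tI; rewrite inE eqxx.
exists (r ++ s); split; first by move=> d; rewrite mem_cat => /orP[/rI|/sI].
move=> c /[!inE]/orP[/eqP->|/st].
  apply: gen_ideal_trans rb => d ds.
  by apply: gen_ideal_in; rewrite mem_cat (ds : d \in r).
apply: gen_ideal_trans => d ds.
by apply: gen_ideal_in; rewrite mem_cat (ds : d \in s) orbT.
Qed.

Lemma noetherian_field (F : fieldType) : noetherian F.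
Proof.
move=> I; have [[x [Ix x0]]|nI] := pselect (exists x, I x /\ x != 0).
  exists [:: x]; split; first by move=> a /[!inE]/eqP ->.
  move=> a _ J [_ _ JM] xJ; rewrite -(mulfVK x0 a); apply/JM/xJ.
  by rewrite /= inE.
exists [::]; split=> // a Ia J [J0 _ _] _.
have [->//|a0] := eqVneq a 0; case: nI; by exists a.
Qed.

Lemma noetherian_surj (R S : comNzRingType) (phi : {rmorphism R -> S}) :
  (forall b, exists a, phi a = b) -> noetherian R -> noetherian S.
Proof.
move=> phiS noethR I; have [s [sI Is]] := noethR (fun a => I (phi a)).
exists (map phi s); split; first by move=> _ /mapP[a /sI ? ->].
move=> b; have [a <-] := phiS b => /Is aS J [J0 JD JM] sJ.
apply: (aS (fun a => J (phi a))).
  split; first by rewrite rmorph0.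
    by move=> c d; rewrite rmorphD; exact: JD.
  by move=> c d; rewrite rmorphM; exact: JM.
by move=> c cs; apply: sJ; exact: map_f.
Qed.

(** The chain condition: finitely many of the [l i] generate the ideal of all of them, and N exceeds
    their indices. *)
Lemma noetherian_seq (R : comNzRingType) (l : nat -> R) : noetherian R ->
  exists N, gen_ideal (fun a => exists2 i, (i < N)%N & a = l i) (l N).
Proof.
move=> noethR; have [s [sl ls]] := noethR (fun a => exists i, a = l i).
suff [N sN] : exists N, forall a, a \in s -> exists2 i, (i < N)%N & a = l i.
  exists N; apply: gen_ideal_trans (ls (l N) _); last by exists N.
  by move=> a /sN ?; exact: gen_ideal_in.
elim: s sl {ls} => [|b s IH] sl; first by exists 0%N.
have [|N sN] := IH; first by move=> a sa; apply: sl; rewrite inE sa orbT.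
have [|i bi] := sl b; first by rewrite inE eqxx.
exists (maxn N i.+1) => a /[!inE]/orP[/eqP->|/sN[j jN ->]].
  by exists i => //; rewrite leq_max leqnn orbT.
by exists j => //; rewrite leq_max jN.
Qed.

(* Otherwise there is a sequence of elements of I, each of minimal degree
   outside the ideal generated by the previous ones; its leading coefficients
   contradict noetherian_seq. *)
Lemma noetherian_poly (R : comNzRingType) : noetherian R -> noetherian {poly R}.
Proof.
move=> noethR I; apply: contrapT => nI.
(* The condition on s sits inside the existential so that choice gives a total function; 0 is the
   default value for other s. *)
have next (s : seq {poly R}) : exists f, (forall a, a \in s -> gen_ideal I a) ->
    [/\ gen_ideal I f, ~ gen_ideal (fun b => b \in s) f & forall g, gen_ideal I g ->
        ~ gen_ideal (fun b => b \in s) g -> (size f <= size g)%N].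
  have [sI|nsI] := pselect (forall a, a \in s -> gen_ideal I a); last by exists 0.
  pose P n := `[< exists f,
    [/\ gen_ideal I f, ~ gen_ideal (fun b => b \in s) f & size f = n] >].
  have exP : exists n, P n.
    apply: contrapT => nP; apply: nI; have [t [tI ts]] := gen_ideal_seqs sI.
    exists t; split=> // a Ia; apply: gen_ideal_trans ts _ _.
    apply: contrapT => nsa; apply: nP; exists (size a); apply/asboolP.
    by exists a; split=> //; exact: gen_ideal_in.
  case: (ex_minnP exP) => n /asboolP[f [fI nsf szf]] nmin.
  exists f => _; split=> // g gI nsg; rewrite szf; apply: nmin.
  by apply/asboolP; exists g.
have [nx nxP] := choice next.
pose fs := fix fs n := if n is m.+1 then nx (fs m) :: fs m else [::].
pose f n := nx (fs n).
have fsI n a : a \in fs n -> gen_ideal I a.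
  elim: n a => [//|n IH] a /=; rewrite inE => /orP[/eqP ->|]; last exact: IH.
  by have [] := nxP (fs n) IH.
have fsS n m : (n <= m)%N -> {subset fs n <= fs m}.
  elim: m => [|m IH]; first by rewrite leqn0 => /eqP ->.
  rewrite leq_eqVlt => /orP[/eqP ->//|/IH nm a /nm am].
  by rewrite /= inE am orbT.
have fmin n m : (n <= m)%N -> (size (f n) <= size (f m))%N.
  move=> nm; have [fI nf _] := nxP (fs m) (@fsI m).
  have [_ _] := nxP (fs n) (@fsI n); apply=> // fsn; apply: nf.
  apply: gen_ideal_trans fsn => a an.
  by apply: gen_ideal_in; exact: fsS an.
have [N genN] := noetherian_seq (fun n => lead_coef (f n)) noethR.
have [fI nf fNmin] := nxP (fs N) (@fsI N).
have [G0 GD GM] := gen_ideal_ideal (fun b => b \in (fs N)).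
have fN0 : f N != 0 by apply/eqP => f0; apply: nf; rewrite -/(f N) f0.
set n := (size (f N)).-1.
have szn : size (f N) = n.+1 by rewrite prednK// size_poly_gt0.
(* [genN] is applied to the ideal of coefficients of index n of the polynomials of degree at most n
   in the ideal of the previous terms. It contains the previous leading coefficients, by multiplying
   with powers of X, hence that of [f N]; subtracting g then lowers the degree of [f N], against
   minimality. *)
have [||g [gfs szg gn]] := genN (fun l => exists g,
    [/\ gen_ideal (fun b => b \in (fs N)) g, (size g <= n.+1)%N & g`_n = l]).
- split; first by exists 0; rewrite size_poly0 coef0.
    move=> a b [g [gG gn ga]] [h [hG hn hb]]; exists (g + h).
    rewrite coefD ga hb; split=> //; first exact: GD.
    by rewrite (leq_trans (size_polyD _ _))// geq_max gn.
  move=> c a [g [gG gn ga]]; exists (c%:P * g); rewrite coefCM ga; split=> //.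
    exact: GM.
  by rewrite mul_polyC (leq_trans (size_scale_leq _ _)).
- move=> _ [i iN ->].
  have fi0 : f i != 0.
    have [_ nfi _] := nxP (fs i) (@fsI i); apply/eqP => f0; apply: nfi.
    by rewrite -/(f i) f0; have [] := gen_ideal_ideal (fun b => b \in (fs i)).
  have szi : (size (f i) <= n.+1)%N by rewrite -szn fmin// ltnW.
  exists ('X^(n.+1 - size (f i)) * f i); split.
  + apply: (GM); apply: gen_ideal_in; apply: (fsS i.+1 N iN).
    exact: mem_head.
  + by rewrite mulrC size_mulXn// subnK.
  + rewrite coefXnM ltnNge leq_subLR; 
    case: (size (f i)) (size_poly_gt0 (f i)) (lead_coefE (f i)) szi.
      by rewrite fi0.
    move=> m _ -> szi; rewrite addSn ltnS leq_addl /= subSS subKn//.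
have : (size (f N) <= size (f N - g)%R)%N.
  apply: fNmin.
    have [_ ID IM] := gen_ideal_ideal I; apply: ID => //.
    rewrite -mulN1r; apply: IM; apply: gen_ideal_trans gfs.
    exact: fsI.
  move=> fg; apply: nf; rewrite -/(f N) -(subrK g (f N)); exact: GD.
rewrite szn; apply/negP; rewrite -ltnNge ltnS; apply/leq_sizeP => j.
rewrite leq_eqVlt => /orP[/eqP <-|nj].
  by rewrite coefB gn lead_coefE -/n subrr.
by rewrite coefB !nth_default ?subrr// ?szn// (leq_trans szg).
Qed.

(** Induction on n: polynomials in n+1 variables are the image of one-variable polynomials over
    those in n variables, X going to the last variable. *)
Lemma noetherian_mpoly (F : fieldType) n : noetherian (mpoly n F).
Proof.
elim: n => [|n IH].
  apply: (noetherian_surj (phi := mpolyC 0 (R := F))); last exact: noetherian_field.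
  elim/mpolyind => [|c m p _ _ [a <-]]; first by exists 0; rewrite rmorph0.
  exists (c + a); rewrite rmorphD/=; congr (_ + _).
  have -> : m = mnm0 by apply/mnmP => -[].
  by rewrite mpolyX0 alg_mpolyC.
pose phi : {rmorphism {poly mpoly n F} -> mpoly n.+1 F} :=
  horner_eval (mpolyX F (mnm1 ord_max)) \o map_poly (@mwiden n F).
apply: (noetherian_surj (phi := phi)); last exact: noetherian_poly.
have phiX i : exists a, phi a = mpolyX F (mnm1 i).
  case: (unliftP ord_max i) => [j ->|->].
    exists (mpolyX F (mnm1 j))%:P; rewrite /phi/= /horner_eval map_polyC hornerC/=.
    rewrite mwidenX mnmwiden1; congr (mpolyX _ (mnm1 _)).
    by apply/val_inj; rewrite /= /bump leqNgt ltn_ord.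
  by exists 'X; rewrite /phi /= /horner_eval map_polyX hornerX.
elim/mpolyind => [|c m p _ _ [a <-]]; first by exists 0; rewrite rmorph0.
have [b bm] : exists b, phi b = mpolyX F m.
  rewrite mpolyXE_id.
  apply: (big_ind (fun q => exists b, phi b = q)) => [|x y [a' <-] [b' <-]|i _].
  - by exists 1; rewrite rmorph1.
  - by exists (a' * b'); rewrite rmorphM.
  - by have [a' <-] := phiX i; exists (a' ^+ m i); rewrite rmorphXn.
exists ((mpolyC n c)%:P * b + a); rewrite rmorphD rmorphM bm -mul_mpolyC.
congr (_ * _ + _).
by rewrite /phi /= /horner_eval map_polyC hornerC /= mwidenC.
Qed.

End Noetherian.

(** * Functions with a closed graph *)

Lemma frac_numden (R : idomainType) (u : {fraction R}) :
  exists n d, d != 0 /\ FracField.tofrac d * u = FracField.tofrac n.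
Proof.
elim/generic_quotient.quotW: u => x; exists (\n_x), (\d_x).
split; first exact: denom_ratioP.
unlock FracField.tofrac; rewrite -[LHS]FracField.pi_mul.
rewrite /FracField.mulf /= !numden_Ratio ?oner_neq0 ?denom_ratioP// mul1r.
apply/eqmodP/eqP; rewrite /= !numden_Ratio ?oner_neq0 ?denom_ratioP//.
by rewrite mulr1.
Qed.

Section GraphOfFunction.
Variables (k : closedFieldType) (K : fieldType) (A : comNzRingType).
Variables (iota : {rmorphism A -> K}) (X : Type) (D : X -> Prop).
Variable ev : X -> {rmorphism A -> k}.
Hypothesis char0 : [pchar K] =i pred0.
Hypothesis iota0 : forall p, iota p = 0 <-> forall x, D x -> ev x p = 0.
Hypothesis iota_frac : forall u, exists p q, iota q != 0 /\ iota q * u = iota p.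
Variable a : X -> k.
Hypothesis a_closed : forall x t, D x -> t != a x -> exists h : {poly A},
  (map_poly (ev x) h).[t] != 0 /\
  forall y, D y -> (map_poly (ev y) h).[a y] = 0.

(** The ideal of the graph of [a] over D. By [iota0] and [iota_frac], K is the fraction field of A
    modulo the functions vanishing on D. *)
Let J (h : {poly A}) := forall y, D y -> (map_poly (ev y) h).[a y] = 0.
Local Notation "h ^i" := (map_poly iota h) (at level 2, format "h ^i").

Lemma iotaP0 h : h^i = 0 -> forall x, D x -> map_poly (ev x) h = 0.
Proof.
move=> h0 x Dx; apply/polyP => i; rewrite coef_map coef0 /=.
by apply: (proj1 (iota0 _)) Dx; rewrite -coef_map h0 coef0.
Qed.

Lemma clear_denominators (P : {poly K}) :
  exists c p, iota c != 0 /\ p^i = iota c *: P.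
Proof.
elim/poly_ind: P => [|P u [c [p [c0 pP]]]].
  by exists 1, 0; rewrite !rmorph0 scaler0 rmorph1 oner_neq0.
have [b [q [q0 qb]]] := iota_frac u.
exists (q * c), ((q%:P * p * 'X) + (c * b)%:P).
rewrite rmorphM mulf_neq0//; split=> //.
rewrite rmorphD !rmorphM/= map_polyX !map_polyC/= pP -qb scalerDr.
rewrite !mul_polyC -!scalerAl scalerA; congr (_ + _).
by rewrite -!mul_polyC -!polyCM mulrCA mulrA.
Qed.

Lemma graph_minimal_small (S : {poly A}) : (forall h, J h -> iota (lead_coef h) != 0 ->
  (size S <= size h)%N) ->
  forall h, J h -> (size h^i < size S)%N -> h^i = 0.
Proof.
move=> Smin h; have [n] := ubnP (size h); elim: n h => // n IH h szn Jh szh.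
have [l0|l0] := eqVneq (iota (lead_coef h)) 0; last first.
  have := Smin _ Jh l0; rewrite leqNgt => /negP[].
  by rewrite size_map_poly_id0// in szh.
have [->|h0] := eqVneq h 0; first by rewrite rmorph0.
pose g := take_poly (size h).-1 h.
have hE : h = g + lead_coef h *: 'X^((size h).-1).
  apply/polyP => i; rewrite coefD coefZ coefXn coef_take_poly.
  case: ltngtP => ih; rewrite ?mulr0 ?addr0 ?mulr1 ?add0r//.
    by rewrite nth_default//; move: ih; rewrite -ltnS prednK// size_poly_gt0.
  by rewrite ih.
have gE : g^i = h^i.
  by rewrite [in RHS]hE rmorphD/= map_polyZ l0 scale0r addr0.
rewrite -gE; apply: IH; last by rewrite gE.
  rewrite (leq_ltn_trans (size_take_poly _ _))// -ltnS prednK// size_poly_gt0//.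
move=> y Dy; have := Jh y Dy; rewrite [in X in X -> _]hE rmorphD/= map_polyZ/=.
by rewrite (proj1 (iota0 _) l0 _ Dy) scale0r addr0.
Qed.

(** Pseudo-division by S: the remainder is again in J and is shorter than S. *)
Lemma graph_minimal_div (S h : {poly A}) : (forall h, J h -> iota (lead_coef h) != 0 ->
  (size S <= size h)%N) -> J S -> iota (lead_coef S) != 0 -> J h ->
  exists e q r, [/\ lead_coef S ^+ e *: h = q * S + r & r^i = 0].
Proof.
move=> Smin JS S0 Jh; exists (Pdiv.Ring.rscalp h S), (Pdiv.Ring.rdivp h S),
  (Pdiv.Ring.rmodp h S).
have eqn := Pdiv.ComRing.rdivp_eq S h; split=> //.
apply: (graph_minimal_small Smin).
  move=> y Dy; have /(congr1 (fun p => (map_poly (ev y) p).[a y])) := eqn.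
  rewrite map_polyZ/= hornerZ (Jh y Dy) mulr0 rmorphD rmorphM/= hornerD hornerM.
  by rewrite (JS y Dy) mulr0 add0r => <-.
rewrite (leq_ltn_trans (size_poly _ _))// Pdiv.Ring.ltn_rmodp.
by apply: contra_neq S0 => ->; rewrite lead_coef0 rmorph0.
Qed.

(** If S = v u^2 over K, then (u v)^2 = v S, so u v cleared of denominators vanishes on the graph
    because its square does; being shorter than S, it is zero. Characteristic 0 excludes factors
    with zero derivative. *)
Lemma graph_minimal_separable (S : {poly A}) : (forall h, J h -> iota (lead_coef h) != 0 ->
  (size S <= size h)%N) -> J S -> iota (lead_coef S) != 0 ->
  separable_poly S^i.
Proof.
move=> Smin JS S0; have Si0 : S^i != 0.
  by rewrite -lead_coef_eq0 lead_coef_map_id0// rmorph0.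
apply/separable_polyP; split; last first.
  move=> u uS szu; apply/eqP => /(congr1 (fun p : {poly K} => p`_(size u).-2)).
  rewrite coef_deriv coef0 -[X in X = 0]mulr_natr; move/eqP.
  rewrite mulf_eq0 (proj1 (pcharf0P _) char0) orbF.
  case: (size u) (lead_coefE u) szu => [|[|m]]//= <- _.
  by rewrite lead_coef_eq0 => /eqP u0; move: uS; rewrite u0 dvd0p (negPf Si0).
apply/poly_square_freeP => u szu; apply/negP => /dvdpP[v vE].
have u0 : u != 0 by apply: contra_neq Si0 => u0; rewrite vE u0 expr0n/= mulr0.
have v0 : v != 0 by apply: contra_neq Si0 => v0; rewrite vE v0 mul0r.
have [c [w [c0 wE]]] := clear_denominators (u * v).
have [c' [v' [c'0 vE']]] := clear_denominators v.
have Jw : J (c' *: w).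
  have : (c' *: w ^+ 2 - c ^+ 2 *: (v' * S))^i = 0.
    rewrite rmorphB/= !map_polyZ !rmorphXn/= !rmorphM/= wE vE' vE.
    by rewrite -!mul_polyC polyC_exp; ring.
  move=> /iotaP0 w2 y Dy; have /(congr1 (fun p => p.[a y])) := w2 y Dy.
  rewrite rmorphB/= !map_polyZ !rmorphXn/= !rmorphM/= !hornerE/= JS// !mulr0 subr0.
  by move/eqP; rewrite mulf_eq0 => /orP[/eqP|/eqP ->]; rewrite ?mulr0.
have : (c' *: w)^i = 0.
  apply: (graph_minimal_small Smin Jw).
  rewrite map_polyZ wE !size_scale// -(size_map_poly_id0 S0)//.
  rewrite vE [v * _]mulrC expr2 -mulrA [ltnRHS]size_mul ?mulf_neq0//.
  move: (size (u * v)) => m'.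
  move: szu; rewrite -size_poly_gt0 in u0; case: (size u) u0 => [|[|m]]//= _ _.
  by rewrite !addSn /= ltnS leq_addl.
move/eqP; rewrite map_polyZ wE !scaler_eq0 (negPf c0) (negPf c'0)/=.
by rewrite mulf_eq0 (negPf u0) (negPf v0).
Qed.

(* Where the leading coefficient and the discriminant of S do not vanish, S has
   deg S distinct roots, and all of them are the value of a. *)
Lemma graph_degree1 (Q : {poly A}) : J Q -> iota (lead_coef Q) != 0 ->
  exists s b, [/\ iota s != 0, forall x, D x -> ev x s * a x = ev x b &
    forall h, J h -> root h^i (iota b / iota s)].
Proof.
move=> JQ Q0.
pose P n := `[< exists h, [/\ J h, iota (lead_coef h) != 0 & size h = n] >].
have exP : exists n, P n by exists (size Q); apply/asboolP; exists Q.
case: (ex_minnP exP) => m /asboolP[S [JS S0 szS]] Smin'.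
have Smin h : J h -> iota (lead_coef h) != 0 -> (size S <= size h)%N.
  by move=> Jh h0; rewrite szS; apply: Smin'; apply/asboolP; exists h.
have Sdiv h Jh := graph_minimal_div (h := h) Smin JS S0 Jh.
have := graph_minimal_separable Smin JS S0.
rewrite unlock => /Bezout_eq1_coprimepP[[u v] /= uv].
have [c [u' [c0 uE]]] := clear_denominators u.
have [c' [v' [c'0 vE]]] := clear_denominators v.
(* The Bezout identity between S and its derivative over K, cleared of denominators and evaluated at
   the points of D. *)
have bez x : D x ->
  map_poly (ev x) (c' *: u' * S + c *: v' * S^`()) = (ev x (c * c'))%:P.
  move=> Dx; rewrite -map_polyC; apply/eqP; rewrite -subr_eq0 -rmorphB; apply/eqP.
  apply: iotaP0 Dx; rewrite rmorphB rmorphD !rmorphM/= !map_polyZ/= uE vE.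
  rewrite -deriv_map !scalerA [iota c' * _]mulrC -!scalerAl -scalerDr uv.
  by rewrite !map_polyC/= -polyCM alg_polyC subrr.
(* Such a point exists because the product is nonzero in K, hence not identically zero on D. *)
have [x [Dx gx]] : exists x, D x /\ ev x (c * c' * lead_coef S) != 0.
  apply: contrapT => nx; have : iota (c * c' * lead_coef S) != 0.
    by rewrite !rmorphM/= !mulf_neq0.
  move/eqP; apply; apply/iota0 => x Dx; apply: contrapT => /eqP gx.
  by apply: nx; exists x.
have [cx Sx] : ev x (c * c') != 0 /\ ev x (lead_coef S) != 0.
  by move: gx; rewrite [ev x (_ * lead_coef S)]rmorphM mulf_eq0 negb_or => /andP[].
(* Another root would be separated from the graph by some h in J, but a power of the leading
   coefficient times h is a multiple of S over x. *)
have Sroot t : root (map_poly (ev x) S) t -> t = a x.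
  move=> /eqP St; apply: contrapT => /eqP/(a_closed Dx)[h [hx Jh]].
  have [e [q [r [hE r0]]]] := Sdiv _ Jh.
  have /(congr1 (fun p => (map_poly (ev x) p).[t])) := hE.
  rewrite map_polyZ rmorphD rmorphM/= (iotaP0 r0 Dx) addr0 hornerZ hornerM St.
  by apply/eqP; rewrite mulr0 mulf_neq0// rmorphXn expf_neq0.
have szSx : size (map_poly (ev x) S) = size S by rewrite size_map_poly_id0.
(* A constant S could not vanish on the graph. In degree at least 2, S at x would have two roots,
   equal by [Sroot], and a double root contradicts [bez]. *)
have sz2 : size S = 2%N.
  apply/eqP; rewrite eqn_leq; apply/andP; split; last first.
    rewrite ltnNge; apply/negP => /size1_polyC SC.
    move: (JS x Dx) Sx; rewrite SC map_polyC hornerC lead_coefC /= => ->.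
    by rewrite eqxx.
  rewrite leqNgt; apply/negP => sz3.
  have /closed_rootP[t rt] : size (map_poly (ev x) S) != 1%N.
    by rewrite szSx; case: (size S) sz3 => [|[]].
  have /factor_theorem[q qE] := rt.
  have q0 : q != 0.
    by apply/eqP => q0; move: szSx sz3; rewrite qE q0 mul0r size_poly0 => <-.
  have /closed_rootP[t' rt'] : size q != 1%N.
    move: szSx sz3; rewrite qE size_Mmonic ?monicXsubC// size_XsubC addn2/= => <-.
    by case: (size q) => [|[]].
  have tt' : t' = t.
    by rewrite (Sroot _ rt) (Sroot t')// qE rootM rt'.
  move: rt'; rewrite tt' => rt'.
  have /(congr1 (fun p => p.[t])) := bez x Dx.
  rewrite rmorphD !rmorphM/= -deriv_map qE derivM derivXsubC mulr1 !hornerE/=.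
  rewrite (eqP rt') subrr !(mulr0, mul0r, addr0) => /esym/eqP.
  by rewrite -rmorphM (negPf cx).
exists (lead_coef S), (- S`_0); split=> //.
  move=> y Dy; have := JS y Dy; rewrite (horner_coef_wide (n := 2)); last first.
    by rewrite (leq_trans (size_poly _ _))// sz2.
  rewrite !big_ord_recl big_ord0 /= !coef_map/= expr0 expr1 mulr1 addr0.
  rewrite lead_coefE sz2 /bump/= => /eqP; rewrite addrC addr_eq0 => /eqP ->.
  by rewrite rmorphN.
move=> h Jh; have [e [q [r [hE r0]]]] := Sdiv _ Jh.
have /(congr1 (fun p => p^i.[iota (- S`_0) / iota (lead_coef S)])) := hE.
rewrite map_polyZ rmorphD rmorphM/= r0 addr0 hornerZ hornerM.
rewrite [S^i.[_]](horner_coef_wide (n := 2)); last first.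
  by rewrite (leq_trans (size_poly _ _))// sz2.
rewrite !big_ord_recl big_ord0 /= !coef_map/= expr0 expr1 mulr1 addr0.
rewrite -[S`_(bump 0 0)]/(S`_1) [S`_1](_ : _ = lead_coef S); last first.
  by rewrite lead_coefE sz2.
rewrite mulrCA divff// mulr1 rmorphN subrr mulr0 => /eqP.
by rewrite mulf_eq0 rmorphXn expf_eq0 (negPf S0) andbF.
Qed.

End GraphOfFunction.

(* The hypotheses on a say that its graph is closed in D x k and that it is
   integral over R. *)
Lemma regular_of_closed_graph (k : closedFieldType) (A : comNzRingType)
    (R : idomainType) (rho : {rmorphism A -> R}) (X : Type) (D : X -> Prop)
    (ev : X -> {rmorphism A -> k}) (a : X -> k) (Q : {poly A}) :
  [pchar k] =i pred0 -> (exists x, D x) ->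
  integrally_closed R ->
  (forall p, rho p = 0 <-> forall x, D x -> ev x p = 0) ->
  (forall r, exists p q, rho q \is a GRing.unit /\ rho q * r = rho p) ->
  (forall x t, D x -> t != a x -> exists h : {poly A},
    (map_poly (ev x) h).[t] != 0 /\
    forall y, D y -> (map_poly (ev y) h).[a y] = 0) ->
  (forall y, D y -> (map_poly (ev y) Q).[a y] = 0) ->
  rho (lead_coef Q) \is a GRing.unit ->
  exists p q, rho q \is a GRing.unit /\
    forall x, D x -> ev x q != 0 -> a x = ev x p / ev x q.
Proof.
move=> char0 [x0 Dx0] intR rho0 rhoF a_closed JQ Qunit.
pose K : fieldType := {fraction R}.
pose iota : {rmorphism A -> K} := @FracField.tofrac R \o rho.
have iotaE p : iota p = FracField.tofrac (rho p) by [].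
have iota0 p : iota p = 0 <-> forall x, D x -> ev x p = 0.
  by rewrite -rho0 iotaE; split=> [/eqP|->]; rewrite ?rmorph0// tofrac_eq0 => /eqP.
have charK : [pchar K] =i pred0.
  apply/pcharf0P => m; have /pcharf0P km := char0.
  rewrite -(rmorph_nat iota); apply/eqP/eqP => [/iota0/(_ _ Dx0)|->]; last first.
    exact: rmorph0.
  by move=> /eqP; rewrite rmorph_nat km => /eqP.
have iotaF u : exists p q, iota q != 0 /\ iota q * u = iota p.
  have [n [d [d0 du]]] := frac_numden u.
  have [p [q [qU qn]]] := rhoF n; have [p' [q' [q'U q'd]]] := rhoF d.
  exists (p * q'), (q * p'); split.
    rewrite iotaE tofrac_eq0 rmorphM -q'd !mulf_neq0//.
      by apply: contraTneq qU => ->; rewrite unitr0.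
    by apply: contraTneq q'U => ->; rewrite unitr0.
  rewrite !iotaE !rmorphM/= -q'd -qn !rmorphM/= -!mulrA du.
  by rewrite ![_ * FracField.tofrac n]mulrC mulrA.
have lQ : iota (lead_coef Q) != 0.
  by rewrite iotaE tofrac_eq0; apply: contraTneq Qunit => ->; rewrite unitr0.
have [s [b [s0 sab roots]]] := graph_degree1 charK iota0 iotaF a_closed JQ lQ.
(* Q divided by its leading coefficient, a unit of R, is a monic equation for b / s. *)
have [r ur] : exists r, iota b / iota s = FracField.tofrac r.
  apply: intR; exists ((rho (lead_coef Q))^-1 *: map_poly rho Q).
    rewrite monicE lead_coefZ lead_coef_map_id0 ?rmorph0 ?mulVr//.
    by apply: contraTneq Qunit => ->; rewrite unitr0.
  rewrite map_polyZ rootZ; last first.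
    by rewrite tofrac_eq0 invr_eq0; apply: contraTneq Qunit => ->; rewrite unitr0.
  by rewrite -map_poly_comp; exact: roots.
have [p [q [qU qr]]] := rhoF r.
have q0 : iota q != 0.
  by rewrite iotaE tofrac_eq0; apply: contraTneq qU => ->; rewrite unitr0.
exists p, q; split=> // x Dx qx.
have spqb : forall y, D y -> ev y (s * p - q * b) = 0.
  apply/iota0; rewrite rmorphB !rmorphM (iotaE p) -qr [FracField.tofrac _]rmorphM.
  rewrite -[X in _ * (_ * X)]ur -[X in _ * (X * _)]/(iota q).
  by rewrite mulrCA [iota s * _]mulrCA mulfV// mulr1 subrr.
(* The relations s a = b and b / s = p / q settle only the points where s is nonzero. In general the
   closed graph is used: an h in J nonzero at (x, p x / q x) is divided by q X - p. *)
apply/eqP; apply: contrapT => /negP; rewrite eq_sym => /(a_closed _ _ Dx)[h [hx Jh]].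
pose S := q%:P * 'X + (- p)%:P.
have szS : size S = 2%N.
  rewrite size_MXaddC polyC_eq0; case: eqP => [q'0|_] /=.
    by move: qx; rewrite q'0 rmorph0 eqxx.
  by rewrite size_polyC; case: eqP => // q'0; move: qx; rewrite q'0 rmorph0 eqxx.
have lS : lead_coef S = q.
  by rewrite lead_coefE szS coefD coefMX !coefC /= addr0.
have := Pdiv.ComRing.rdivp_eq S h.
set e := Pdiv.Ring.rscalp h S; set g := Pdiv.Ring.rdivp h S => hE.
have [c rE] : exists c, Pdiv.Ring.rmodp h S = c%:P.
  exists (Pdiv.Ring.rmodp h S)`_0; apply: size1_polyC.
  by rewrite -ltnS -szS Pdiv.Ring.ltn_rmodp -size_poly_gt0 szS.
have ev_hE y t : ev y q ^+ e * (map_poly (ev y) h).[t] =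
    (map_poly (ev y) g).[t] * (ev y q * t - ev y p) + ev y c.
  have /(congr1 (fun P => (map_poly (ev y) P).[t])) := hE.
  rewrite rE lS map_polyZ rmorphD rmorphM/= rmorphD rmorphM/= map_polyX !map_polyC/=.
  by rewrite !hornerE/= rmorphXn rmorphN.
(* On the graph, s (q a - p) = q b - s p vanishes, hence so does s c; and s is nonzero in the field
   K. *)
have c0 y : D y -> ev y c = 0.
  move: y; apply/iota0; have : iota (s * c) = 0.
    apply/iota0 => y Dy; rewrite rmorphM.
    have := ev_hE y (a y); rewrite Jh// mulr0 => /(congr1 (fun z => ev y s * z)).
    rewrite mulr0 mulrDr mulrCA mulrBr mulrCA sab// -!rmorphM -rmorphB.
    by rewrite -opprB rmorphN spqb// oppr0 mulr0 add0r.
  by move/eqP; rewrite rmorphM mulf_eq0 (negPf s0) => /eqP.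
have := ev_hE x (ev x p / ev x q); rewrite c0// addr0 mulrCA divff// mulr1.
rewrite subrr mulr0 => /eqP; apply/negP.
by rewrite mulf_neq0// expf_neq0.
Qed.

(** * Elimination *)

Lemma rmorph_mmap (A R S : comNzRingType) n (f : {rmorphism A -> R})
    (g : {rmorphism R -> S}) (l : 'I_n -> R) (f' : {rmorphism A -> S})
    (l' : 'I_n -> S) (p : mpoly n A) :
  (forall a, g (f a) = f' a) -> (forall i, g (l i) = l' i) ->
  g (mmap f l p) = mmap f' l' p.
Proof.
move=> ff' ll'; rewrite /mmap rmorph_sum; apply: eq_bigr => m _.
rewrite rmorphM ff'; congr (_ * _); rewrite /mmap1 rmorph_prod.
by apply: eq_bigr => i _; rewrite rmorphXn ll'.
Qed.

(** As the leading coefficients survive, the degrees and the shape of the Sylvester matrix are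
    preserved. *)
Lemma rmorph_resultant (A B : comNzRingType) (f : {rmorphism A -> B})
    (p q : {poly A}) : f (lead_coef p) != 0 -> f (lead_coef q) != 0 ->
  f (resultant p q) = resultant (map_poly f p) (map_poly f q).
Proof.
move=> fp fq; rewrite /resultant /Sylvester_mx !size_map_poly_id0// -det_map_mx.
congr (\det _); apply/matrixP => i j; rewrite !mxE.
by case: fintype.split => u; rewrite !mxE /= !rVpoly_delta !coefXnM coef_map;
  case: ifP; rewrite ?rmorph0.
Qed.

(** For t nonzero the value is t^M g(1/t). Since M exceeds the degree of g, the reversal has an
    extra factor t and vanishes at 0 as well. *)
Lemma horner_rev_poly (F : fieldType) (g : {poly F}) M t :
  (size g <= M)%N -> (t != 0 -> g.[t^-1] = 0) ->
  (\poly_(i < M.+1) g`_(M - i)).[t] = 0.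
Proof.
move=> gM gt; have [->|t0] := eqVneq t 0.
  by rewrite horner_coef0 coef_poly /= subn0 nth_default.
rewrite horner_poly; have := gt t0.
rewrite (horner_coef_wide _ (leqW gM)) => /(congr1 (fun z => t ^+ M * z)).
rewrite mulr0 mulr_sumr => sum0; rewrite -[RHS]sum0 (reindex_inj rev_ord_inj) /=.
apply: eq_bigr => i _; rewrite subSS subKn ?leq_ord// mulrCA exprVn.
by rewrite expfB_cond ?(negPf t0) ?leq_ord.
Qed.

Section Elimination.
Variables (k : closedFieldType) (A : comNzRingType) (cst : {rmorphism k -> A}).
Variables (X : Type) (D : X -> Prop) (ev : X -> {rmorphism A -> k}).
Hypothesis ev_cst : forall x c, ev x (cst c) = c.
Variable n : nat.
Local Notation B := (mpoly n A).

Definition ev_at (x : X) (v : 'rV[k]_n) : B -> k := mmap (ev x) (v ord0).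
HB.instance Definition _ x v := GRing.RMorphism.on (ev_at x v).

(* F is closed over x: the points of the fibre outside F x are cut out by
   polynomials vanishing on F. *)
Definition separated_at (F : X -> {vspace 'rV[k]_n}) (x : X) : Prop :=
  forall v, v \notin F x -> exists h : B, ev_at x v h != 0 /\
    forall y w, D y -> w \in F y -> ev_at y w h = 0.

Implicit Types (F : X -> {vspace 'rV[k]_n}) (e v w : 'rV[k]_n).

Definition add_line F e y : {vspace 'rV[k]_n} := (F y + <[e]>)%VS.

Let T i : B := mpolyX A (mnm1 i).
Let C a : B := mpolyC n (cst a).

Lemma ev_atX x v i : ev_at x v (T i) = v ord0 i.
Proof. by rewrite /ev_at mmapX mmap1U. Qed.

Lemma ev_atC x v c : ev_at x v (mpolyC n c) = ev x c.
Proof. exact: mmapC. Qed.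

Lemma ev_atCst x v c : ev_at x v (C c) = c.
Proof. by rewrite ev_atC ev_cst. Qed.

Lemma ev_at_line (h : B) (l : 'I_n -> {poly B}) x v w t :
  (forall i, (map_poly (ev_at x v) (l i)).[t] = w ord0 i) ->
  (map_poly (ev_at x v) (mmap (polyC \o mpolyC n (R := A)) l h)).[t]
    = ev_at x w h.
Proof.
move=> lw; apply: (rmorph_mmap
  (g := horner_eval t \o map_poly (ev_at x v))) => [c|i] /=.
  by rewrite /horner_eval map_polyC hornerC /= ev_atC.
exact: lw.
Qed.

(* f is the reversal of the polynomial s |-> h(e + s v), where h vanishes on F
   but not at e: v + t e is in F y if and only if e + t^-1 v is, for t != 0. *)
Lemma line_polynomial F x0 e : separated_at F x0 -> e \notin F x0 ->
  exists (f : {poly B}) (q : A), [/\ (1 < size f)%N, ev x0 q != 0,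
    forall y v, ev_at y v (lead_coef f) = ev y q,
    forall y v t, D y -> v + t *: e \in F y ->
      (map_poly (ev_at y v) f).[t] = 0 &
    forall y, D y -> ev y q != 0 -> e \notin F y].
Proof.
move=> sepF /sepF[h [he hF]].
pose G := mmap (polyC \o mpolyC n (R := A))
  (fun i => (C (e ord0 i))%:P + (T i)%:P * 'X) h.
have GE y v t : (map_poly (ev_at y v) G).[t] = ev_at y (e + t *: v) h.
  apply: ev_at_line => i; rewrite rmorphD rmorphM/= map_polyX !map_polyC/=.
  by rewrite !hornerE/= ev_atCst ev_atX !mxE mulrC.
(* q is y |-> h(y, e). It gives the values of the constant coefficient of G, which becomes the
   leading coefficient of f; where it is nonzero, h keeps e out of F y. *)
pose q := mmap idfun (fun i => cst (e ord0 i)) h.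
have qE y : ev y q = ev_at y e h.
  by apply: (rmorph_mmap (g := ev y)) => // i; rewrite ev_cst.
pose f := \poly_(i < (size G).+1) G`_(size G - i).
have G0E y v : ev_at y v G`_0 = ev y q.
  by rewrite -coef_map -horner_coef0 GE scale0r addr0 qE.
have G0 : G`_0 != 0.
  by apply: contra_neq he => G0; rewrite -qE -(G0E _ 0) G0 rmorph0.
have szf : size f = (size G).+1 by rewrite size_poly_eq//= subnn.
exists f, q; split.
- rewrite szf ltnS size_poly_gt0; apply: contra_neq G0 => ->; exact: coef0.
- by rewrite qE.
- by move=> y v; rewrite lead_coefE szf coef_poly ltnSn /= subnn G0E.
- move=> y v t Dy vF.
  have -> : map_poly (ev_at y v) f =
      \poly_(i < (size G).+1) (map_poly (ev_at y v) G)`_(size G - i).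
    by apply/polyP => i; rewrite coef_map /= coef_poly [RHS]coef_poly coef_map;
      case: ifP => // _; rewrite rmorph0.
  apply: horner_rev_poly; first exact: size_poly.
  move=> t0; rewrite GE; apply: hF => //.
  suff -> : e + t^-1 *: v = t^-1 *: (v + t *: e) by exact: memvZ.
  by rewrite scalerDr scalerA mulVf// scale1r addrC.
- by move=> y Dy; rewrite qE; apply: contra => eF; rewrite hF.
Qed.

(** Interpolation of an equation for the incidence w + t e in F y. If g vanishes at the new value
    t0, an equation H nonzero there is added, multiplied by P, which vanishes at the values already
    treated but not at t0. *)
Lemma avoid_roots F x v e (s : seq k) : separated_at F x ->
  (forall t, t \in s -> v + t *: e \notin F x) ->
  exists g : {poly B},
    (forall y w t, D y -> w + t *: e \in F y ->
      (map_poly (ev_at y w) g).[t] = 0) /\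
    forall t, t \in s -> (map_poly (ev_at x v) g).[t] != 0.
Proof.
move=> sepF; elim: s => [|t0 s IH] sF.
  by exists 0; split=> // y w t _ _; rewrite rmorph0 horner0.
have [|g [gF gs]] := IH; first by move=> t ts; apply: sF; rewrite inE ts orbT.
have [gt0|gt0] := eqVneq (map_poly (ev_at x v) g).[t0] 0; last first.
  by exists g; split=> // t /[!inE]/orP[/eqP ->|/gs].
have [h [ht0 hF]] := sepF _ (sF t0 (mem_head _ _)).
pose H := mmap (polyC \o mpolyC n (R := A))
  (fun i => (T i)%:P + (C (e ord0 i))%:P * 'X) h.
have HE y w t : (map_poly (ev_at y w) H).[t] = ev_at y (w + t *: e) h.
  apply: ev_at_line => i; rewrite rmorphD rmorphM/= map_polyX !map_polyC/=.
  by rewrite !hornerE/= ev_atCst ev_atX !mxE mulrC.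
pose P := \prod_(t <- s) ('X - (C t)%:P).
have PE y w : map_poly (ev_at y w) P = \prod_(t <- s) ('X - t%:P).
  rewrite rmorph_prod; apply: eq_bigr => t _.
  by rewrite rmorphB/= map_polyX map_polyC/= ev_atCst.
exists (g + P * H); split=> [y w t Dy wF|t].
  by rewrite rmorphD rmorphM/= hornerD hornerM gF// HE hF// mulr0 addr0.
rewrite rmorphD rmorphM/= hornerD hornerM HE PE inE => /orP[/eqP ->|ts].
  rewrite gt0 add0r mulf_neq0// -[_ != 0]/(~~ root _ t0) root_prod_XsubC.
  by apply/negP => /gs/eqP.
suff -> : (\prod_(t <- s) ('X - t%:P)).[t] = 0 by rewrite mul0r addr0; exact: gs.
by apply/eqP; rewrite -[_ == 0]/(root _ t) root_prod_XsubC.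
Qed.

(* The equations of F + <e> are the resultants in t of f and g, where
   g (y, v, t) vanishes when v + t e is in F y; adding a multiple of f by a high
   power of t makes the leading coefficient of g nonzero at x. *)
Lemma separated_add_line F e (f : {poly B}) (q : A) x :
  separated_at F x -> ev x q != 0 -> (1 < size f)%N ->
  (forall y v, ev_at y v (lead_coef f) = ev y q) ->
  (forall y v t, D y -> v + t *: e \in F y ->
    (map_poly (ev_at y v) f).[t] = 0) ->
  separated_at (add_line F e) x.
Proof.
move=> sepF qx szf leadf fF v vF.
have lf : ev_at x v (lead_coef f) != 0 by rewrite leadf.
have [r rE] := closed_field_poly_normal (map_poly (ev_at x v) f).
have [|g [gF gr]] := @avoid_roots F x v e r sepF.
  move=> t _; apply: contra vF => vF; apply/memv_addP.
  exists (v + t *: e) => //; exists (- t *: e).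
    by rewrite memvZ// memv_line.
  by rewrite scaleNr addrK.
have f0 : f != 0 by rewrite -size_poly_gt0 ltnW.
pose g' := f * 'X^(size g) + g.
have szfX : size (f * 'X^(size g)) = (size g + size f)%N by rewrite size_mulXn.
have szlt : (size g < size (f * 'X^(size g))%R)%N.
  by rewrite szfX -[X in (X < _)%N]addn0 ltn_add2l size_poly_gt0.
have lg : lead_coef g' = lead_coef f by rewrite lead_coefDl// lead_coef_Mmonic// monicXn.
have szg : (1 < size g')%N.
  by rewrite size_polyDl// szfX (leq_trans szf)// leq_addl.
exists (resultant f g'); split; last first.
  move=> y w Dy /memv_addP[u uF [_ /vlineP[t ->] wE]].
  (* The resultant is a combination of f and g', which both vanish at the parameter - t since w - t
     e lies in F y. *)
  have [[U W] /= _ UW] := resultant_in_ideal szf szg.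
  have utF : w + (- t) *: e \in F y by rewrite wE scaleNr addrK.
  have /(congr1 (fun p => (map_poly (ev_at y w) p).[- t])) := UW.
  rewrite map_polyC hornerC rmorphD !rmorphM/= => ->.
  rewrite rmorphD rmorphM/= !hornerD !hornerM hornerD hornerM.
  by rewrite (fF _ _ _ Dy utF) (gF _ _ _ Dy utF) !(mul0r, mulr0, addr0).
(* If the resultant vanished at (x, v), a common root z of f and g' would be a root of f where g
   vanishes; but g was chosen to avoid the roots of f. *)
rewrite rmorph_resultant ?lg// resultant_eq0; apply/negP => sz1.
have /closed_rootP[z] : size (gcdp (map_poly (ev_at x v) f)
  (map_poly (ev_at x v) g')) != 1%N by case: (size _) sz1 => [|[]].
rewrite root_gcd => /andP[fz]; rewrite /root rmorphD rmorphM/= hornerD hornerM.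
rewrite (eqP fz) mul0r add0r => gz.
have : z \in r.
  move: fz; rewrite rE rootZ ?root_prod_XsubC//.
  by rewrite lead_coef_map_id0 ?rmorph0.
by move=> /gr; rewrite gz.
Qed.

Definition add_span F (s : seq 'rV[k]_n) y : {vspace 'rV[k]_n} :=
  (F y + <<s>>)%VS.

Lemma notin_add_span F x c s : (F x :&: <<c :: s>>)%VS = 0%VS ->
  free (c :: s) -> c \notin add_span F s x.
Proof.
move=> Fs; rewrite free_cons => /andP[cs _]; apply: contra cs.
move=> /memv_addP[u uF [w ws cE]].
suff u0 : u = 0 by rewrite cE u0 add0r.
apply/eqP; rewrite -memv0 -Fs memv_cap uF/=.
have -> : u = c - w by rewrite cE addrK.
rewrite memvB//; first by rewrite memv_span// mem_head.
by apply: subvP ws; apply: sub_span => z zs; rewrite inE zs orbT.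
Qed.

(** Lines are added one at a time. Independence of s modulo F x0 keeps each new vector outside the
    sum already formed over x0, as [line_polynomial] requires; q collects the leading
    coefficients. *)
Lemma separated_add_span F x0 (s : seq 'rV[k]_n) : D x0 ->
  (forall y, D y -> separated_at F y) ->
  (F x0 :&: <<s>>)%VS = 0%VS -> free s ->
  exists2 q, ev x0 q != 0 & forall y, D y -> ev y q != 0 ->
    separated_at (add_span F s) y.
Proof.
move=> Dx0 sepF; elim: s => [|c s IH] Fs frs.
  exists 1; first by rewrite rmorph1 oner_neq0.
  move=> y Dy _; have -> : add_span F [::] = F; last exact: sepF.
  by apply/funext => z; rewrite /add_span span_nil addv0.
have ssub : (<<s>> <= <<c :: s>>)%VS.
  by apply: sub_span => z zs; rewrite inE zs orbT.
have [||q qx0 sepq] := IH.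
- by apply/eqP; rewrite -subv0 -Fs capvS ?subvv.
- by move: frs; rewrite free_cons => /andP[].
have cF := notin_add_span Fs frs.
have [f [q' [szf q'x0 leadf fF _]]] := line_polynomial (sepq _ Dx0 qx0) cF.
exists (q * q'); first by rewrite rmorphM mulf_neq0.
move=> y Dy; rewrite rmorphM mulf_eq0 negb_or => /andP[qy q'y].
have -> : add_span F (c :: s) = add_line (add_span F s) c.
  by apply/funext => z; rewrite /add_span /add_line span_cons [(<[c]> + _)%VS]addvC addvA.
exact: (separated_add_line (sepq _ Dy qy) q'y szf leadf fF).
Qed.

End Elimination.

(** * Projections along the fibres *)

Section Projection.
Variables (k : closedFieldType) (A : comNzRingType) (R : idomainType).
Variables (cst : {rmorphism k -> A}) (rho : {rmorphism A -> R}).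
Variables (X : Type) (D : X -> Prop) (ev : X -> {rmorphism A -> k}) (x0 : X).
Hypothesis char0 : [pchar k] =i pred0.
Hypothesis ev_cst : forall x c, ev x (cst c) = c.
Hypothesis Dx0 : D x0.
Hypothesis intR : integrally_closed R.
Hypothesis rho_ev : forall p q, ev x0 q != 0 ->
  (forall x, D x -> ev x q != 0 -> ev x p = 0) -> rho p = 0.
Hypothesis ev_rho : forall p, rho p = 0 -> forall x, D x -> ev x p = 0.
Hypothesis rho_unit : forall q, ev x0 q != 0 <-> rho q \is a GRing.unit.
Hypothesis rho_frac : forall r, exists p q,
  rho q \is a GRing.unit /\ rho q * r = rho p.
Variable n : nat.
Implicit Types (F : X -> {vspace 'rV[k]_n}) (v w : 'rV[k]_n).

(** Regularity at x0 in algebraic form, on D. In this section A stands for a ring of functions, R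
    for the local ring at x0 and [rho] for taking germs. *)
Definition fraction_near (a : X -> k) : Prop :=
  exists p q, ev x0 q != 0 /\
    forall x, D x -> ev x q != 0 -> a x = ev x p / ev x q.

Lemma fraction_near_cst c : fraction_near (fun=> c).
Proof.
exists (cst c), 1; rewrite rmorph1 oner_neq0; split=> // x _ _.
by rewrite rmorph1 ev_cst divr1.
Qed.

Lemma fraction_nearD a b : fraction_near a -> fraction_near b ->
  fraction_near (fun x => a x + b x).
Proof.
move=> [p [q [q0 aE]]] [p' [q' [q'0 bE]]].
exists (p * q' + p' * q), (q * q'); rewrite rmorphM mulf_neq0//; split=> // x Dx.
rewrite rmorphM mulf_eq0 negb_or => /andP[qx q'x].
by rewrite aE// bE// addf_div// rmorphD !rmorphM.
Qed.

Lemma fraction_nearM a b : fraction_near a -> fraction_near b ->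
  fraction_near (fun x => a x * b x).
Proof.
move=> [p [q [q0 aE]]] [p' [q' [q'0 bE]]].
exists (p * p'), (q * q'); rewrite rmorphM mulf_neq0//; split=> // x Dx.
rewrite rmorphM mulf_eq0 negb_or => /andP[qx q'x].
by rewrite aE// bE// mulf_div !rmorphM.
Qed.

Lemma fraction_near_sum m (a : 'I_m -> X -> k) :
  (forall i, fraction_near (a i)) -> fraction_near (fun x => \sum_i a i x).
Proof.
elim: m a => [|m IH] a fa.
  have -> : (fun x => \sum_i a i x) = fun=> 0.
    by apply/funext => x; rewrite big_ord0.
  exact: fraction_near_cst.
have -> : (fun x => \sum_i a i x) =
    fun x => \sum_i a (widen_ord (leqnSn m) i) x + a ord_max x.
  by apply/funext => x; rewrite big_ord_recr.
by apply: fraction_nearD => //; apply: IH.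
Qed.

Lemma common_denominator (T : eqType) (P : T -> X -> Prop) (s : seq T) :
  (forall i, i \in s -> exists2 q, ev x0 q != 0 &
     forall x, D x -> ev x q != 0 -> P i x) ->
  exists2 q, ev x0 q != 0 &
    forall x, D x -> ev x q != 0 -> forall i, i \in s -> P i x.
Proof.
elim: s => [|i s IH] Ps; first by exists 1; rewrite ?rmorph1 ?oner_neq0.
have [|q q0 qP] := IH; first by move=> j js; apply: Ps; rewrite inE js orbT.
have [|q' q'0 q'P] := Ps i; first by rewrite inE eqxx.
exists (q * q'); first by rewrite rmorphM mulf_neq0.
move=> x Dx; rewrite rmorphM mulf_eq0 negb_or => /andP[qx q'x] j.
by rewrite inE => /orP[/eqP ->|]; [exact: q'P|exact: qP].
Qed.

(** Pulled back along (y, t) |-> w - t c, the equations of F show that the graph of [a] is closed,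
    and [line_polynomial] in the direction [- c] gives an equation of [a] whose leading coefficient
    is a unit at x0; [regular_of_closed_graph] applies. *)
Lemma coordinate_fraction F (c w : 'rV[k]_n) (a : X -> k) q1 :
  ev x0 q1 != 0 -> c \notin F x0 ->
  (forall y, D y -> ev y q1 != 0 -> separated_at D ev F y) ->
  (forall y t, D y -> ev y q1 != 0 -> (w - t *: c \in F y) = (t == a y)) ->
  fraction_near a.
Proof.
move=> q1x0 cF sepF aP.
have [f [q [szf qx0 leadf fF _]]] : exists (f : {poly mpoly n A}) (q : A),
    [/\ (1 < size f)%N, ev x0 q != 0,
      forall y v, ev_at ev y v (lead_coef f) = ev y q,
      forall y v t, D y -> v + t *: (- c) \in F y ->
        (map_poly (ev_at ev y v) f).[t] = 0 &
      forall y, D y -> ev y q != 0 -> - c \notin F y].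
  by apply: (line_polynomial ev_cst (sepF _ Dx0 q1x0)); rewrite memvN.
pose D1 y := D y /\ ev y q1 != 0.
pose s : {rmorphism mpoly n A -> A} := mmap idfun (fun i => cst (w ord0 i)).
have ev_s y h : ev y (s h) = ev_at ev y w h.
  by apply: (rmorph_mmap (g := ev y)) => // i; rewrite ev_cst.
have sf0 : s (lead_coef f) != 0.
  by apply: contra_neq qx0 => sf0; rewrite -(leadf _ w) -ev_s sf0 rmorph0.
pose Q := map_poly s f.
have [|||||p [q' [q'U pq']]] := @regular_of_closed_graph k A R rho X D1 ev a Q
    char0 _ intR _ rho_frac.
- by exists x0.
- move=> p; split=> [rp y [Dy _]|pD]; first exact: ev_rho.
  by apply: (@rho_ev _ q1) => // y Dy qy; exact: pD.
- move=> x t [Dx qx]; rewrite -aP// => /(sepF _ Dx qx)[h [hx hF]].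
  pose H := mmap (@polyC A)
    (fun i => (cst (w ord0 i))%:P - (cst (c ord0 i))%:P * 'X) h.
  have HE y u : (map_poly (ev y) H).[u] = ev_at ev y (w - u *: c) h.
    apply: (rmorph_mmap (g := horner_eval u \o map_poly (ev y))) => [b|i] /=.
      by rewrite /horner_eval map_polyC hornerC.
    rewrite /horner_eval rmorphB rmorphM/= map_polyX !map_polyC/=.
    by rewrite !hornerE/= !ev_cst !mxE mulrC.
  exists H; split; first by rewrite HE.
  by move=> y [Dy qy]; rewrite HE hF// aP.
- move=> y [Dy qy]; rewrite /Q -map_poly_comp.
  rewrite (eq_map_poly (g := ev_at ev y w)); last by move=> h; exact: ev_s.
  by apply: fF => //; rewrite scalerN aP.
- apply/rho_unit; rewrite lead_coef_map_id0// ?rmorph0//.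
  by rewrite ev_s leadf.
(* The factor q1 confines the formula to the points where q1 is nonzero. *)
exists (p * q1), (q' * q1); split.
  by rewrite rmorphM mulf_neq0//; exact/rho_unit.
move=> x Dx; rewrite !rmorphM mulf_eq0 negb_or => /andP[q'x qx].
by rewrite pq'// -mulf_div divff// mulr1.
Qed.

(* P y is the projection along F y onto a complement of F x0 that does not
   depend on y. *)
Lemma projection_fraction F d : (forall y, D y -> \dim (F y) = d) ->
  (forall y, D y -> separated_at D ev F y) ->
  exists (P : X -> 'M[k]_n) (q : A), [/\ ev x0 q != 0,
    forall i j, fraction_near (fun y => P y i j) &
    forall y, D y -> ev y q != 0 -> [/\ P y *m P x0 = P y,
      P x0 *m P y = P x0 & forall v, (v \in F y) = (v *m P y == 0)]].
Proof.
move=> dimF sepF; pose W := ((F x0)^C)%VS.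
pose C := vbasis W; have spanC : <<C>>%VS = W by exact: (span_basis (vbasisP W)).
have frC : free C := basis_free (vbasisP W).
have uC : uniq C := free_uniq frC.
have FW0 : (F x0 :&: <<C>>)%VS = 0%VS by rewrite spanC capv_compl.
have permC c : c \in C -> perm_eq C (c :: rem c C) by exact: perm_to_rem.
(* One q1 for all basis vectors c: closedness comes from [separated_add_span], and c stays outside
   the sum by the last clause of [line_polynomial]. *)
have [q1 q1x0 q1P] : exists2 q, ev x0 q != 0 &
    forall y, D y -> ev y q != 0 -> forall c, c \in (C : seq _) ->
      separated_at D ev (add_span F (rem c C)) y /\ c \notin add_span F (rem c C) y.
  apply: common_denominator => c cC.
  have frc : free (c :: rem c C) by rewrite -(perm_free (permC _ cC)).
  have spc : <<c :: rem c C>>%VS = <<C>>%VS.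
    by apply/eq_span => z; rewrite -(perm_mem (permC _ cC)).
  have Fc : (F x0 :&: <<c :: rem c C>>)%VS = 0%VS by rewrite spc.
  have cF := notin_add_span Fc frc.
  have frr : free (rem c C) by move: frc; rewrite free_cons => /andP[].
  have Fr : (F x0 :&: <<rem c C>>)%VS = 0%VS.
    by apply/eqP; rewrite -subv0 -Fc capvS ?subvv// span_cons addvSr.
  have [q qx0 sepq] := separated_add_span ev_cst Dx0 sepF Fr frr.
  have [f [q' [_ q'x0 _ _ cq']]] := line_polynomial ev_cst (sepq _ Dx0 qx0) cF.
  exists (q * q'); first by rewrite rmorphM mulf_neq0.
  move=> y Dy; rewrite rmorphM mulf_eq0 negb_or => /andP[qy q'y].
  by split; [exact: sepq|exact: cq'].
have memC (i : 'I_(\dim W)) : C`_i \in (C : seq _) by rewrite mem_nth ?size_tuple.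
have memrem (i j : 'I_(\dim W)) : j != i -> C`_j \in rem C`_i C.
  move=> ji; rewrite mem_rem_uniq// inE memC andbT nth_uniq ?size_tuple//.
have others (a : 'I_(\dim W) -> k) (i : 'I_(\dim W)) :
    \sum_(j | j != i) a j *: C`_j \in <<rem C`_i C>>%VS.
  by apply: memv_suml => j ji; apply/memvZ/memv_span/memrem.
(* A vector of the intersection with nonzero i-th coordinate would put the i-th basis vector in F y
   plus the span of the others. *)
have disj y : D y -> ev y q1 != 0 -> (<<C>> :&: F y)%VS = 0%VS.
  move=> Dy qy; apply/eqP; rewrite -subv0; apply/subvP => v.
  rewrite memv_cap memv0 => /andP[/coord_span vE vF]; rewrite vE big1// => i _.
  have [->|ci] := eqVneq (coord C i v) 0; first by rewrite scale0r.
  have [_ /negP[]] := q1P y Dy qy _ (memC i).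
  have vi : C`_i = (coord C i v)^-1 *:
      (v + - \sum_(j | j != i) coord C j v *: C`_j).
    by rewrite {2}vE (bigD1 i)//= addrK scalerA mulVf// scale1r.
  rewrite [X in X \in _]vi; apply: memvZ; apply: memv_add => //.
  by rewrite memvN; exact: others.
(* Dimension count, from the constancy of the dimension of F y. *)
have full y : D y -> ev y q1 != 0 -> (<<C>> + F y)%VS = fullv.
  move=> Dy qy; apply/eqP; rewrite eqEdim subvf/= dimv_disjoint_sum; last exact: disj.
  rewrite dimF// spanC dimv_compl dimF//.
  by rewrite -leq_subLR subKn// -(dimF _ Dx0) dimvS// subvf.
pose pr y : 'End('rV[k]_n) := daddv_pi <<C>> (F y).
have prC y v : pr y v \in <<C>>%VS by exact: memv_pi.
have prF y v : D y -> ev y q1 != 0 -> v - pr y v \in F y.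
  move=> Dy qy; have := daddv_pi_add (disj y Dy qy) (w := v).
  rewrite full// memvf => /(_ isT) {1}<-.
  by rewrite addrC addKr memv_pi.
have pr_id y v : D y -> ev y q1 != 0 -> v \in <<C>>%VS -> pr y v = v.
  by move=> Dy qy; apply: daddv_pi_id; exact: disj.
exists (fun y => lin1_mx (pr y)), q1; split=> //.
  (* An entry is a combination with constant coefficients of the coordinates of the projection of e;
     each is the function [a] of [coordinate_fraction] with w = e and c the l-th vector of C. *)
  move=> i j; pose e : 'rV[k]_n := delta_mx 0 i.
  have -> : (fun y => lin1_mx (pr y) i j) =
      fun y => \sum_l coord C l (pr y e) * C`_l ord0 j.
    apply/funext => y; rewrite mxE /= {1}(coord_span (prC y e)) summxE.
    by apply: eq_bigr => l _; rewrite mxE.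
  apply: fraction_near_sum => l; apply: fraction_nearM; last exact: fraction_near_cst.
  apply: (@coordinate_fraction (add_span F (rem C`_l C)) C`_l e _ q1) => //.
  - by have [] := q1P _ Dx0 q1x0 _ (memC l).
  - by move=> y Dy qy; have [] := q1P _ Dy qy _ (memC l).
  move=> y t Dy qy; have [_ lF] := q1P _ Dy qy _ (memC l).
  have prE : \sum_(j | j != l) coord C j (pr y e) *: C`_j +
      coord C l (pr y e) *: C`_l = pr y e.
    by rewrite [RHS](coord_span (prC y e)) [RHS](bigD1 l)//= addrC.
  have eE : e - t *: C`_l = (e - pr y e + \sum_(j | j != l) coord C j (pr y e) *: C`_j)
      + (coord C l (pr y e) - t) *: C`_l.
    by rewrite scalerBl addrA -[_ + _ + _ *: _]addrA prE subrK.
  have restF : e - pr y e + \sum_(j | j != l) coord C j (pr y e) *: C`_j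
      \in add_span F (rem C`_l C) y by rewrite memv_add// prF.
  rewrite eE rpredDl//; apply/idP/eqP => [cF|->]; last by rewrite subrr scale0r mem0v.
  apply/eqP; rewrite eq_sym -subr_eq0; apply: contraNT lF => ct.
  by have := memvZ (coord C l (pr y e) - t)^-1 cF; rewrite scalerA mulVf// scale1r.
move=> y Dy qy.
have prv z v : v *m lin1_mx (pr z) = pr z v by rewrite mul_rV_lin1.
split.
- by apply/row_matrixP => i; rewrite row_mul prv rowE prv pr_id.
- by apply/row_matrixP => i; rewrite row_mul prv rowE prv pr_id.
- move=> v; rewrite prv; apply/idP/eqP => [vF|v0].
    have : pr y v \in (<<C>> :&: F y)%VS.
      by rewrite memv_cap prC/= -(subrK v (pr y v)) memvD// -opprB memvN prF.
    by rewrite disj// memv0 => /eqP.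
  by rewrite -[v]subr0 -v0 prF.
Qed.

End Projection.

(** * Morphisms and affine charts *)

Lemma near_all (T : topologicalType) (x : T) (P : T -> Prop) :
  (forall y, P y) -> \forall y \near x, P y.
Proof. by move=> allP; apply: filterS filterT. Qed.

Lemma nbhs_continuous (S T : topologicalType) (f : S -> T) x (W : set T) :
  continuous f -> nbhs (f x) W -> nbhs x (f @^-1` W).
Proof. by move=> fc; exact: fc. Qed.

Lemma continuous_nbhs (S T : topologicalType) (f : S -> T) :
  (forall x (W : set T), nbhs (f x) W -> nbhs x (f @^-1` W)) -> continuous f.
Proof. by move=> fW x W; exact: fW. Qed.

Section FunSpaces.
Context (k : fieldType).
Implicit Types X Y Z : fun_space k.

Lemma regular_sum X (I : finType) (x : X) (f : I -> X -> k) :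
  (forall i, regular_at x (f i)) -> regular_at x (fun y => \sum_i f i y).
Proof.
move=> fr; rewrite (_ : (fun _ => _) = \sum_i f i); last first.
  by apply/funext => y; rewrite fct_sumE.
elim/big_ind: _ => [|g h gr hr|i _]; [exact: regular_cst|exact: regularD|exact: fr].
Qed.

Lemma regular_peval X n (x : X) (f : X -> 'rV[k]_n) (p : mpoly n k) :
  (forall i, regular_at x (fun y => f y ord0 i)) ->
  regular_at x (fun y => peval p (f y)).
Proof.
move=> fr; elim/mpolyind: p => [|c m p _ _ IH].
  rewrite (_ : (fun _ => _) = fun=> 0); first exact: regular_cst.
  by apply/funext => y; rewrite /peval meval0.
rewrite (_ : (fun _ => _) = 
  fun y => c * \prod_(i < n) f y ord0 i ^+ m i + peval p (f y)).
  apply: regularD => //; apply: regularM; first exact: regular_cst.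
  rewrite (_ : (fun _ => _) = \prod_(i < n) (fun y => f y ord0 i ^+ m i)); last first.
    by apply/funext => y; rewrite fct_prodE.
  elim/big_ind: _ => [|g h gr hr|i _]; [exact: regular_cst|exact: regularM|].
  elim: (m i) => [|j IHj]; first exact: regular_cst.
  rewrite (_ : (fun _ => _) = fun y => f y ord0 i * f y ord0 i ^+ j).
    exact: regularM.
  by apply/funext => y; rewrite exprS.
by apply/funext => y; rewrite /peval mevalD mevalZ mevalX.
Qed.

Lemma morphism_comp X Y Z (f : X -> Y) (g : Y -> Z) :
  morphism f -> morphism g -> morphism (g \o f).
Proof.
move=> [fc fr] [gc gr]; split=> [x|x h /gr/fr//].
by apply: continuous_comp; [exact: fc|exact: gc].
Qed.

Lemma morphism_val X (A : set X) : morphism (set_val : induced_space A -> X).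
Proof.
split; first exact: (@initial_continuous (set_type A) X set_val).
by move=> a g gr; exists g => //; exact: near_all.
Qed.

Lemma nbhs_induced X (A : set X) (a : induced_space A) (W : set (induced_space A)) :
  nbhs a W -> exists2 N, nbhs (set_val a) N &
    forall b : induced_space A, N (set_val b) -> W b.
Proof.
move=> [B [[O oO <-] Oa] BW]; exists O; first exact: open_nbhs_nbhs.
by move=> b Ob; exact: BW.
Qed.

Lemma morphism_induced X Y (A : set X) (f : Y -> induced_space A) :
  morphism (set_val \o f) -> morphism f.
Proof.
move=> [fc fr]; split=> [|y g [h hr gh]].
  apply: continuous_nbhs => y W /nbhs_induced[N Nf NW].
  by apply: filterS (nbhs_continuous fc Nf) => z /NW.
have [N Nf NW] := nbhs_induced gh.
apply: (regular_germ _ (fr y h hr)).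
by apply: filterS (nbhs_continuous fc Nf) => z /NW /esym.
Qed.

(** Tensor functions pull back to regular functions on Z. As they define both the basic open sets
    and the regular functions of the product, continuity and regularity follow. *)
Lemma morphism_pair X Y Z (f : Z -> X) (g : Z -> Y) :
  morphism f -> morphism g ->
  @morphism k Z (product_space X Y) (fun z => (f z, g z)).
Proof.
move=> [fc fr] [gc gr].
have tensor_regular z h : tensor_at (f z, g z) h ->
    regular_at z (fun z' => h (f z', g z')).
  move=> [I [a [b [ar br hE]]]].
  rewrite (_ : (fun _ => _) = fun z' => \sum_i a i (f z') * b i (g z')).
    apply: regular_sum => i; apply: regularM.
    - exact: (fr _ _ (ar i)).
    - exact: (gr _ _ (br i)).
  by apply/funext => z'; rewrite hE.
split=> [|z h [p [q [pr qr qz hE]]]].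
  apply: continuous_nbhs => z W [O [oO Oz OW]].
  have [h [hr hz [U [V [Uf Vg UV]]]]] := oO _ Oz.
  have hz' := regular_neq0 (tensor_regular _ _ hr) hz.
  apply: filterS (filterI hz' (filterI (nbhs_continuous fc Uf) (nbhs_continuous gc Vg))).
  by move=> z' [/= hz0 [Uz Vz]]; apply/OW/UV.
have [O [oO Oz OE]] := hE.
apply: (@regular_germ k Z z (fun z' => p (f z', g z') * (q (f z', g z'))^-1)).
  have [h' [hr hz [U [V [Uf Vg UV]]]]] := oO _ Oz.
  have hz' := regular_neq0 (tensor_regular _ _ hr) hz.
  apply: filterS (filterI hz' (filterI (nbhs_continuous fc Uf) (nbhs_continuous gc Vg))).
  by move=> z' [/= hz0 [Uz Vz]]; apply/esym/OE/UV.
by apply: regularM; [|apply: regularV => //]; exact: tensor_regular.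
Qed.

Lemma morphism_fst X Y : @morphism k (product_space X Y) X fst.
Proof.
split=> [|z g gr].
  apply: continuous_nbhs => z W Wz.
  by apply: filterS (near_product Wz (filterT : nbhs z.2 setT)) => t [].
exists (g \o fst), (fun=> 1); split.
- exists unit, (fun=> g), (fun=> fun=> 1); split=> // [_|t].
    exact: regular_cst.
  by rewrite big_const cardT enumT unlock /= mulr1 addr0.
- exact: tensor_cst.
- exact: oner_neq0.
- by apply: near_all => t /=; rewrite divr1.
Qed.

Lemma morphism_snd X Y : @morphism k (product_space X Y) Y snd.
Proof.
split=> [|z g gr].
  apply: continuous_nbhs => z W Wz.
  by apply: filterS (near_product (filterT : nbhs z.1 setT) Wz) => t [].
exists (g \o snd), (fun=> 1); split.
- exists unit, (fun=> fun=> 1), (fun=> g); split=> // [_|t].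
    exact: regular_cst.
  by rewrite big_const cardT enumT unlock /= mul1r addr0.
- exact: tensor_cst.
- exact: oner_neq0.
- by apply: near_all => t /=; rewrite divr1.
Qed.

Lemma morphism_affine n Z (f : Z -> affine_space k n) :
  (forall z i, regular_at z (fun z' => (f z' : 'rV[k]_n) ord0 i)) -> morphism f.
Proof.
move=> fr; have pr z p : regular_at z (fun z' => peval p (f z')).
  by apply: regular_peval => i; exact: fr.
have fc : continuous f.
  apply: continuous_nbhs => z W [O [oO Oz OW]]; have [p pz pO] := oO _ Oz.
  by apply: filterS (regular_neq0 (pr z p) pz) => z' /pO/OW.
split=> // z g [p [q [qz gE]]].
apply: (@regular_germ k Z z (fun z' => peval p (f z') * (peval q (f z'))^-1)).
  by apply: filterS (nbhs_continuous fc gE) => z' /= ->.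
by apply: regularM => //; apply: regularV.
Qed.

Lemma regular_coord n (v : affine_space k n) i :
  regular_at v (fun w : affine_space k n => (w : 'rV[k]_n) ord0 i).
Proof.
exists (mpolyX k (mnm1 i)), (mpolyC n 1).
split; first by rewrite /peval mevalC oner_neq0.
by apply: near_all => w; rewrite /peval mevalC mevalXU divr1.
Qed.

End FunSpaces.

Section Charts.
Context (k : fieldType) (X : fun_space k).

(* phi identifies U with a closed subset of k^m. *)
Definition affine_chart (U : set X) m (phi : X -> 'rV[k]_m) : Prop :=
  [/\ forall x p, U x -> regular_at x (fun y => peval p (phi y)),
      forall x N, U x -> nbhs x N -> exists p, peval p (phi x) != 0 /\
        forall y, U y -> peval p (phi y) != 0 -> N y &
      forall x f, U x -> regular_at x f -> exists p q, peval q (phi x) != 0 /\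
        \forall y \near x, f y = peval p (phi y) / peval q (phi y)].

Lemma affine_chart_exists x0 : variety X ->
  exists (U : set X) (m : nat) (phi : X -> 'rV[k]_m),
    [/\ open U, U x0 & affine_chart U phi].
Proof.
move=> [_ [I [V [oV Vx affV]]]]; have [i Vi] := Vx x0.
have [m [Z [_ [f [fm [g [fgK gfK gm]]]]]]] := affV i.
(* The chart is extended by 0 outside [V i]. *)
pose phi x : 'rV[k]_m := match pselect (V i x) with
  left Vix => set_val (f (SigSub (mem_set Vix))) | right _ => 0 end.
have phiE (a : induced_space (V i)) : phi (set_val a) = set_val (f a).
  rewrite /phi; case: pselect => [Va|]; last by case; exact: set_valP.
  by congr (set_val (f _)); exact: val_inj.
have lift x : V i x -> exists a : induced_space (V i), set_val a = x.
  by move=> Vx'; exists (SigSub (mem_set Vx')).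
have near_lift (a : induced_space (V i)) (P : set X) :
    (\forall b \near a, P (set_val b)) -> nbhs (set_val a) P.
  move=> /nbhs_induced[N Na NP].
  have Va : nbhs (set_val a) (V i).
    by apply: open_nbhs_nbhs; split; [exact: oV|exact: set_valP].
  apply: filterS (filterI Na Va) => y [Ny /lift[b yE]].
  by rewrite -yE; apply: NP; rewrite yE.
exists (V i), m, phi; split=> //; split.
- move=> x p /lift[a <-].
  have : regular_at a (fun b : induced_space (V i) => peval p (set_val (f b))).
    apply: (proj2 fm a (fun c : induced_space Z => peval p (set_val c))).
    apply: (proj2 (morphism_val Z) _ (fun w : affine_space k m => peval p w)).
    by apply: regular_peval => j; exact: regular_coord.
  move=> [h hr hE]; apply: (regular_germ _ hr); apply: near_lift.
  by apply: filterS hE => b; rewrite phiE => ->.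
- move=> x N /lift[a <-] Nx.
  have /gm.1/nbhs_induced[O [O' [oO' O'a] O'O] ON] :
      nbhs (g (f a)) (fun b : induced_space (V i) => N (set_val b)).
    by rewrite fgK; exact: near_induced.
  have [p pa pO] := oO' _ O'a.
  exists p; rewrite phiE; split=> // _ /lift[b <-]; rewrite phiE => /pO/O'O/ON.
  by rewrite /= fgK.
- move=> x h /lift[a <-] hr.
  have : regular_at (f a) (fun c : induced_space Z => h (set_val (g c))).
    apply: (proj2 gm (f a) (fun b : induced_space (V i) => h (set_val b))).
    by rewrite fgK; exact: (proj2 (morphism_val (V i))).
  move=> [h' [p [q [qa h'E]]] hE]; exists p, q; rewrite phiE; split=> //.
  apply: near_lift.
  apply: filterS (nbhs_continuous fm.1
    (filterI hE (@near_induced _ _ Z (f a) _ h'E))) => b [/= + h'b].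
  rewrite fgK => ->.
  by rewrite h'b phiE.
Qed.

End Charts.

(** * Germs and closed subsets of products *)

(** All fractions are put over the product of the denominators. The evaluation e comes after p' and
    q', since one choice must serve all points. *)
Lemma common_denominator_fin (A : comNzRingType) (I : finType) (p q : I -> A) :
  exists (p' : I -> A) (q' : A), forall (k : fieldType) (e : {rmorphism A -> k}),
    ((forall i, e (q i) != 0) -> e q' != 0) /\
    (e q' != 0 -> forall i, e (p i) / e (q i) = e (p' i) / e q').
Proof.
exists (fun i => p i * \prod_(j | j != i) q j), (\prod_i q i) => k e; split.
  by move=> q0; rewrite rmorph_prod; apply/prodf_neq0 => i _.
rewrite rmorph_prod => /prodf_neq0 q0 i.
have r0 : e (\prod_(j | j != i) q j) != 0.
  by rewrite rmorph_prod; apply/prodf_neq0 => j _; exact: q0.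
rewrite [X in _ = _ / X](bigD1 i)//= -rmorph_prod; move: r0.
move: (\prod_(j | j != i) q j) => r r0.
by rewrite rmorphM -mulf_div divff// mulr1.
Qed.

Lemma germ_morphism (k : fieldType) (X : fun_space k) (x : X) (R : idomainType)
    (l : local_ring_at x R) m (phi : X -> 'rV[k]_m) :
  (forall p, regular_at x (fun y => peval p (phi y))) ->
  exists rho : {rmorphism mpoly m k -> R},
    forall p, rho p = germ l (fun y => peval p (phi y)).
Proof.
move=> reg; pose f p := germ l (fun y => peval p (phi y)).
have fD p q : f (p + q) = f p + f q.
  rewrite /f -germD//; congr (germ l _); apply/funext => y.
  by rewrite /peval mevalD.
have fB : zmod_morphism f.
  by move=> p q; apply/eqP; rewrite -subr_eq opprK -fD subrK.
have fM : monoid_morphism f.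
  split=> [|p q].
    by rewrite -(germ1 l) /f; congr (germ l _); apply/funext => y; rewrite /peval rmorph1.
  rewrite /f -germM//; congr (germ l _); apply/funext => y.
  by rewrite /peval mevalM.
pose rho := HB.pack_for {rmorphism mpoly m k -> R} f
  (GRing.isZmodMorphism.Build _ _ f fB) (GRing.isMonoidMorphism.Build _ _ f fM).
by exists rho.
Qed.

Lemma near_seq (T : topologicalType) (x : T) (I : eqType) (s : seq I)
    (P : I -> T -> Prop) : (forall i, i \in s -> \forall y \near x, P i y) ->
  \forall y \near x, forall i, i \in s -> P i y.
Proof.
elim: s => [|i s IH] Ps; first by apply: near_all.
have Pi : \forall y \near x, P i y by apply: Ps; rewrite inE eqxx.
have {}IH : \forall y \near x, forall j, j \in s -> P j y.
  by apply: IH => j js; apply: Ps; rewrite inE js orbT.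
by apply: filterS (filterI Pi IH) => y [iy sy] j /[!inE]/orP[/eqP ->|/sy].
Qed.

Lemma affine_near (k : fieldType) n (v : affine_space k n) (N : set (affine_space k n)) :
  nbhs v N -> exists2 p : mpoly n k, peval p v != 0 & forall w, peval p w != 0 -> N w.
Proof. by move=> [O [oO Ov ON]]; have [p pv pO] := oO _ Ov; exists p => // w /pO/ON. Qed.

Section Separation.
Context (k : closedFieldType) (X : fun_space k).
Context (U : set X) (m : nat) (phi : X -> 'rV[k]_m) (chartU : affine_chart U phi).
Context (V : set X) (n : nat) (F : X -> {vspace 'rV[k]_n}).
Hypothesis openF : open [set z : product_space (induced_space V) (affine_space k n) |
  (z.2 : 'rV[k]_n) \notin F (set_val z.1)].

Let ev (x : X) : {rmorphism mpoly m k -> k} := meval (phi x ord0).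

(** A basic neighbourhood of (x, v) in the complement of F is given by a tensor function h. In the
    chart its factors are locally quotients of polynomials; clearing denominators and multiplying by
    polynomials that vanish off the region of validity gives an equation valid over all of D. *)
Lemma separated_of_open (D : set X) x : D `<=` U `&` V -> D x ->
  separated_at D ev F x.
Proof.
move=> DUV Dx v vF; have [Ux Vx] := DUV x Dx.
have [_ chartN chartR] := chartU.
pose x' : induced_space V := SigSub (mem_set Vx).
have [h [[I [f [g [fr gr hE]]]] hz [N1 [N2 [N1x N2v NF]]]]] :=
  openF (z := (x', v)) vF.
have fP i : exists pq : mpoly m k * mpoly m k, ev x pq.2 != 0 /\
    \forall b \near x', f i b = ev (set_val b) pq.1 / ev (set_val b) pq.2.
  have [f' f'r ff'] := fr i; have [p [q [qx f'E]]] := chartR _ _ Ux f'r.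
  exists (p, q); split=> //.
  apply: filterS (filterI ff' (@near_induced _ _ V x' _ f'E)) => b [-> /=].
  by move=> ->.
have [pq /all_and2[qx fE]] := choice fP.
have gP (i : I) : exists rs : mpoly n k * mpoly n k, peval rs.2 v != 0 /\
    \forall w \near (v : affine_space k n), g i w = peval rs.1 w / peval rs.2 w.
  by have [r [s [sv gE]]] := gr i; exists (r, s).
have [rs /all_and2[sv gE]] := choice gP.
have [N1' N1'x N1'P] := nbhs_induced (filterI N1x (filter_forall _ fE)).
have [p1 [p1x p1N]] := chartN _ _ Ux N1'x.
have [p2 p2v p2N] := affine_near (filterI N2v (filter_forall _ gE)).
have [p' [q' pqE]] := common_denominator_fin (fun i => (pq i).1) (fun i => (pq i).2).
have [r' [s' rsE]] := common_denominator_fin (fun i => (rs i).1) (fun i => (rs i).2).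
pose A := mpoly m k.
have [up ev_up] : exists up : {rmorphism mpoly n k -> mpoly n A},
    forall y w p, ev_at ev y w (up p) = peval p w.
  exists (mmap (mpolyC n (R := A) \o mpolyC m (R := k)) (fun i => mpolyX A (mnm1 i))).
  move=> y w p; apply: (rmorph_mmap (g := ev_at ev y w) (f' := idfun)) => [c|i] /=.
    by rewrite ev_atC; exact: mevalC.
  by rewrite ev_atX.
pose H := mpolyC n (p1 * q') * up (p2 * s') *
  \sum_i mpolyC n (p' i) * up (r' i).
have HE y w : ev_at ev y w H = ev y p1 * ev y q' * (peval p2 w * peval s' w) *
    \sum_i ev y (p' i) * peval (r' i) w.
  rewrite !(rmorphM (ev_at ev y w))/= ev_up ev_atC rmorphM /peval mevalM rmorph_sum.
  congr (_ * _); apply: eq_bigr => i _ /=.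
  by rewrite (rmorphM (ev_at ev y w))/= ev_up ev_atC.
have hHE (y : induced_space V) w : ev (set_val y) p1 != 0 -> peval p2 w != 0 ->
    D (set_val y) -> ev (set_val y) q' != 0 -> peval s' w != 0 ->
    \sum_i ev (set_val y) (p' i) * peval (r' i) w =
    ev (set_val y) q' * peval s' w * h (y, w).
  move=> p1y p2w Dy q'y s'w; rewrite hE mulr_sumr; apply: eq_bigr => i _ /=.
  have [_ /(_ i) fy] := N1'P y (p1N _ (DUV _ Dy).1 p1y).
  have [_ /(_ i) gw] := p2N w p2w.
  rewrite fy gw (proj2 (pqE _ (ev (set_val y))) q'y i).
  have gE' := proj2 (rsE _ (meval (w ord0))) s'w i.
  rewrite /peval in gE' s'w *; rewrite gE' mulf_div [RHS]mulrC divfK//.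
  exact: mulf_neq0.
have q'x : ev x q' != 0 by apply: (proj1 (pqE _ (ev x))).
have s'v : peval s' v != 0 by apply: (proj1 (rsE _ (meval (v ord0)))).
exists H; split.
  by rewrite HE (hHE x')//; rewrite !mulf_neq0.
move=> y w Dy wF; apply/eqP; apply: contraT.
rewrite HE !mulf_eq0 !negb_or => /andP[/andP[/andP[p1y q'y] /andP[p2w s'w]]].
pose y' : induced_space V := SigSub (mem_set (DUV y Dy).2).
rewrite (hHE y')// !mulf_eq0 !negb_or => /andP[_ hyw].
have [N1y _] := N1'P y' (p1N _ (DUV _ Dy).1 p1y).
have [N2w _] := p2N w p2w.
by have := NF (y', w) N1y N2w hyw; rewrite /= wF.
Qed.

End Separation.

(** [projection_fraction] with A the polynomials in the coordinates of an affine chart, R the local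
    ring at x0 and D a small neighbourhood of x0. *)
Lemma local_projection (k : closedFieldType) (X : fun_space k) (x0 : X)
    (V : set X) n (F : X -> {vspace 'rV[k]_n}) d :
  [pchar k] =i pred0 -> variety X -> normal_variety X -> open V -> V x0 ->
  (forall x, V x -> \dim (F x) = d) ->
  open [set z : product_space (induced_space V) (affine_space k n) |
    (z.2 : 'rV[k]_n) \notin F (set_val z.1)] ->
  exists P : X -> 'M[k]_n, (forall i j, regular_at x0 (fun y => P y i j)) /\
    \forall y \near x0, [/\ P y *m P x0 = P y, P x0 *m P y = P x0 &
      forall v, (v \in F y) = (v *m P y == 0)].
Proof.
move=> char0 varX normX oV Vx0 dimF openF.
have [U [m [phi [oU Ux0 chartU]]]] := affine_chart_exists x0 varX.
have [reg _ frac] := chartU; have regx0 p := reg x0 p Ux0.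
have [R [l intR]] := normX x0.
have [rho rhoE] := germ_morphism l regx0.
pose ev x : {rmorphism mpoly m k -> k} := meval (phi x ord0).
have rho0 p : rho p = 0 <-> \forall y \near x0, ev y p = 0.
  rewrite -(rmorph0 rho) !rhoE germ_eq//; split=> pE.
    by apply: filterS pE => y E; rewrite [LHS]E; exact: meval0.
  by apply: filterS pE => y py; rewrite /peval meval0; exact: py.
have ev_near q : ev x0 q != 0 -> \forall y \near x0, ev y q != 0.
  exact: (regular_neq0 (regx0 q)).
(* By noetherianity, the functions that vanish near x0 vanish on a common
   neighbourhood D of x0. *)
have [s [s0 sgen]] := @noetherian_mpoly k m (fun p => rho p = 0).
have near_s : \forall y \near x0, forall p, p \in s -> ev y p = 0.
  by apply: near_seq => p /s0/rho0.
pose D := (U `&` V `&` [set y | forall p, p \in s -> ev y p = 0])°.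
have nearD : nbhs x0 D.
  apply: nbhs_interior; apply: filterI near_s.
  by apply: filterI; exact: open_nbhs_nbhs.
have Dx0 : D x0 := nbhs_singleton nearD.
have DUV : D `<=` U `&` V by move=> y /interior_subset[].
have ev_rho p : rho p = 0 -> forall y, D y -> ev y p = 0.
  move=> /sgen gp y /interior_subset[_ sy].
  apply: (gp (fun q => ev y q = 0)) => [|q /sy//]; split.
  - exact: rmorph0.
  - by move=> a b; rewrite rmorphD => -> ->; rewrite addr0.
  - by move=> c a; rewrite rmorphM => ->; rewrite mulr0.
have rho_ev p q : ev x0 q != 0 ->
    (forall x, D x -> ev x q != 0 -> ev x p = 0) -> rho p = 0.
  move=> q0 pq; apply/rho0.
  by apply: filterS (filterI nearD (ev_near q q0)) => y [Dy]; exact: pq.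
have rho_unit q : ev x0 q != 0 <-> rho q \is a GRing.unit.
  split=> [q0|].
    apply/unitrP; exists (germ l (fun y => (peval q (phi y))^-1)).
    have regV := regularV (regx0 q) q0.
    have qV : germ l (fun y => (peval q (phi y))^-1) * rho q = 1.
      rewrite rhoE -germM// -(germ1 l); apply/germ_eq.
      - exact: regularM.
      - exact: regular_cst.
      - by apply: filterS (ev_near q q0) => y qy; rewrite mulVf.
    by split=> //; rewrite mulrC.
  move=> /unitrP[r [rq _]]; have [g gr gE] := germ_surj l r.
  move: rq; rewrite -gE rhoE -germM// -(germ1 l) => /germ_eq gq.
  have /nbhs_singleton/eqP := gq (regularM gr (regx0 q)) (regular_cst x0 1).
  by apply: contraTneq => q0; rewrite [peval _ _]q0 mulr0 eq_sym oner_neq0.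
have rho_frac r : exists p q, rho q \is a GRing.unit /\ rho q * r = rho p.
  have [f fr <-] := germ_surj l r; have [p [q [q0 fE]]] := frac _ _ Ux0 fr.
  exists p, q; split; first exact/rho_unit.
  rewrite !rhoE -germM//; apply/germ_eq => //; first exact: regularM.
  apply: filterS (filterI fE (ev_near q q0)) => y [/= -> qy].
  by rewrite mulrCA divff ?mulr1.
have [|||P [q [q0 Pfrac Pq]]] := @projection_fraction k (mpoly m k) R
  (mpolyC m (R := k)) rho X D ev x0 char0 _ Dx0 intR rho_ev ev_rho rho_unit rho_frac n F d.
- by move=> x c; exact: mevalC.
- by move=> y /DUV[_]; exact: dimF.
- by move=> y Dy; exact: (separated_of_open chartU openF).
exists P; split; last first.
  by apply: filterS (filterI nearD (ev_near q q0)) => y [Dy]; exact: Pq.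
move=> i j; have [p [q' [q'0 PE]]] := Pfrac i j.
apply: (regular_germ _ (regularM (regx0 p) (regularV (regx0 q') q'0))).
by apply: filterS (filterI nearD (ev_near q' q'0)) => y [Dy qy]; rewrite PE.
Qed.

(** * Trivialisation *)

(** The rank factorisation M = C B; cancelling the injective and surjective factors in C B C B = C B
    leaves B C = 1. It identifies the image of M with a standard space. *)
Lemma idempotent_factor (F : fieldType) n (M : 'M[F]_n) : M *m M = M ->
  exists (C : 'M[F]_(n, \rank M)) (B : 'M[F]_(\rank M, n)),
    C *m B = M /\ B *m C = 1%:M.
Proof.
move=> MM; exists (col_base M), (row_base M); rewrite mulmx_base; split=> //.
apply: (row_free_inj (row_base_free M)); apply: (row_full_inj (col_base_full M)).
by rewrite mul1mx -[row_base M *m _ *m _]mulmxA mulmx_base [LHS]mulmxA mulmx_base.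
Qed.

Section Trivialisation.
Context (k : closedFieldType) (X E : fun_space k) (pi : linear_fibration X E).
Context (F : set E) (W : forall x, {vspace fibre pi x}).
Context (FW : forall x, fibre_at F (W x)).
Context (V : set X) (n : nat).
Variable phi : induced_space (pi @^-1` V) ->
  product_space (induced_space V) (affine_space k n).
Hypothesis phi_morphism : morphism phi.
Variable theta : product_space (induced_space V) (affine_space k n) ->
  induced_space (pi @^-1` V).
Hypothesis phiK : cancel phi theta.
Hypothesis thetaK : cancel theta phi.
Hypothesis theta_morphism : morphism theta.
Hypothesis phi_base : forall e, set_val (phi e).1 = pi (set_val e).
Hypothesis phi_linear : forall x, V x ->
  exists L : {linear fibre pi x -> 'rV[k]_n}, forall (v : fibre pi x) e,
    set_val e = fibre_in v -> (phi e).2 = L v :> 'rV[k]_n.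

Lemma theta_base z : pi (set_val (theta z)) = set_val z.1.
Proof. by rewrite -phi_base thetaK. Qed.

Lemma fibre_in_proj x (v : fibre pi x) : pi (fibre_in v) = x.
Proof.
have : range (fibre_in (l := pi) (x := x)) (fibre_in v) by exists v.
by rewrite fibre_in_range.
Qed.

Lemma fibre_image (x : induced_space V) : exists S : {vspace 'rV[k]_n},
  \dim S = \dim (W (set_val x)) /\
  forall v : 'rV[k]_n, F (set_val (theta (x, v))) <-> v \in S.
Proof.
have [L LP] := phi_linear (set_valP x).
have lift (v : fibre pi (set_val x)) : exists2 e : induced_space (pi @^-1` V),
    set_val e = fibre_in v & phi e = (x, L v : affine_space k n).
  have Vv : fibre_in v \in pi @^-1` V.
    by apply/mem_set; rewrite /preimage /= fibre_in_proj; exact: set_valP.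
  exists (SigSub Vv) => //; apply: injective_projections; last exact: LP.
  by apply: val_inj; rewrite [LHS]phi_base /= fibre_in_proj.
have Linj : injective L.
  move=> v w vw; apply: fibre_in_inj.
  have [e <- ev] := lift v; have [e' <- ew] := lift w.
  by congr set_val; rewrite -(phiK e) -(phiK e') ev ew vw.
exists (linfun L @: W (set_val x))%VS; split.
  apply: limg_dim_eq; apply/eqP; rewrite -subv0.
  have /eqP -> : lker (linfun L) == 0%VS.
    by apply/lker0P => v w; rewrite !lfunE; exact: Linj.
  by rewrite capv0 subvv.
move=> v; have : range (fibre_in (l := pi) (x := set_val x)) (set_val (theta (x, v))).
  by rewrite fibre_in_range /preimage /= theta_base.
move=> [w _ wE]; have Lw : L w = v.
  by have := LP w _ (esym wE); rewrite thetaK.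
rewrite -wE; split=> [/FW wW|/memv_imgP[u uW]].
  by rewrite -Lw -(lfunE L) memv_img.
by rewrite lfunE -Lw => /Linj ->; exact/FW.
Qed.

(** The fibre over y is the kernel of [P y]. The map 1 - P x0 sends it isomorphically onto the
    kernel of [P x0], with inverse 1 - P y, and B and C give coordinates on the latter. Thus [psi]
    is v |-> v C on fibres, with inverse u |-> u B (1 - P y), both regular in y. *)
Lemma sub_trivial (S : X -> {vspace 'rV[k]_n}) (U : set X) (P : X -> 'M[k]_n) x0 :
  (forall (x : induced_space V) (v : 'rV[k]_n),
    F (set_val (theta (x, v))) <-> v \in S (set_val x)) ->
  U `<=` V -> U x0 -> (forall y i j, U y -> regular_at y (fun z => P z i j)) ->
  (forall y, U y -> [/\ P y *m P x0 = P y, P x0 *m P y = P x0 &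
    forall v, (v \in S y) = (v *m P y == 0)]) ->
  trivial_over (sub_fibration FW) U (\rank (1%:M - P x0)).
Proof.
move=> SE UV Ux0 Preg PS.
move: (\rank _) (@idempotent_factor k n (1%:M - P x0)) => r factor.
have PP y : U y -> P y *m P y = P y.
  by move=> /PS[PP0 P0P _]; rewrite -{1}PP0 -mulmxA P0P PP0.
have P0id : (1%:M - P x0) *m (1%:M - P x0) = 1%:M - P x0.
  by rewrite mulmxBl mul1mx mulmxBr mulmx1 PP// subrr subr0.
have [C [B [CB BC]]] := factor P0id.
pose A : set (induced_space F) := sub_fibration FW @^-1` U.
have AU (e : induced_space A) : U (pi (set_val (set_val e))) by exact: set_valP e.
pose toV (e : induced_space A) : induced_space (pi @^-1` V) :=
  SigSub (mem_set (UV _ (AU e) : (pi @^-1` V) (set_val (set_val e)))).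
pose toU (e : induced_space A) : induced_space U := SigSub (mem_set (AU e)).
pose UtoV (x : induced_space U) : induced_space V :=
  SigSub (mem_set (UV _ (set_valP x))).
pose psi (e : induced_space A) : product_space (induced_space U) (affine_space k r) :=
  (toU e, ((phi (toV e)).2 : 'rV[k]_n) *m C).
pose vec (z : product_space (induced_space U) (affine_space k r)) : affine_space k n :=
  (z.2 : 'rV[k]_r) *m B *m (1%:M - P (set_val z.1)).
pose pt z := theta (UtoV z.1, vec z).
have ptF z : F (set_val (pt z)).
  have Uz : U (set_val z.1) by exact: set_valP.
  have [_ _ kerP] := PS _ Uz.
  by apply/SE; rewrite kerP -!mulmxA mulmxBl mul1mx PP// subrr !mulmx0.
have vecC z : vec z *m C = z.2.
  have [PP0 P0P _] := PS _ (set_valP z.1 : U (set_val z.1)).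
  have C0 : (1%:M - P x0) *m C = C by rewrite -CB -mulmxA BC mulmx1.
  have QQ0 : (1%:M - P (set_val z.1)) *m (1%:M - P x0) = 1%:M - P x0.
    by rewrite mulmxBl mul1mx mulmxBr mulmx1 PP0 subrr subr0.
  rewrite /vec -[in LHS]C0 -[LHS]mulmxA [_ *m (_ *m C)]mulmxA QQ0 C0.
  by rewrite -mulmxA BC mulmx1.
have vec_psi e : vec (psi e) = (phi (toV e)).2.
  have Ue : U (pi (set_val (set_val e))) := AU e.
  have [PP0 P0P kerP] := PS _ Ue.
  have ve : ((phi (toV e)).2 : 'rV[k]_n) \in S (pi (set_val (set_val e))).
    have vE : set_val (theta ((phi (toV e)).1, (phi (toV e)).2)) = set_val (set_val e).
      by rewrite -surjective_pairing phiK.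
    have : F (set_val (theta ((phi (toV e)).1, (phi (toV e)).2))).
      by rewrite vE; exact: set_valP.
    by move=> /SE; rewrite phi_base.
  move: ve; rewrite kerP => /eqP ve; rewrite /vec /psi /=.
  rewrite -[_ *m C *m B]mulmxA CB -mulmxA.
  have -> : (1%:M - P x0) *m (1%:M - P (pi (set_val (set_val e)))) =
      1%:M - P (pi (set_val (set_val e))).
    by rewrite mulmxBr mulmx1 mulmxBl mul1mx P0P opprB addrA addrNK.
  by rewrite mulmxBr ve subr0 mulmx1.
pose ptF' z : induced_space F := SigSub (mem_set (ptF z)).
have ptA z : A (ptF' z).
  by rewrite /A /preimage /= /sub_proj /= theta_base; exact: set_valP z.1.
pose chi z : induced_space A := SigSub (mem_set (ptA z)).
have toV_morphism : morphism toV.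
  apply: morphism_induced.
  exact: (morphism_comp (@morphism_val _ _ A) (@morphism_val _ _ F)).
have toU_morphism : morphism toU.
  apply: morphism_induced.
  exact: (morphism_comp (@morphism_val _ _ A) (sub_proj_morphism pi F)).
have UtoV_morphism : morphism UtoV.
  by apply: morphism_induced; exact: (@morphism_val _ _ U).
have psi2_morphism :
    morphism (fun e => ((phi (toV e)).2 : 'rV[k]_n) *m C : affine_space k r).
  apply: morphism_affine => e i.
  rewrite (_ : (fun _ => _) =
    fun e' => \sum_j ((phi (toV e')).2 : 'rV[k]_n) ord0 j * C j i); last first.
    by apply/funext => e'; rewrite mxE.
  apply: regular_sum => j; apply: regularM; last exact: regular_cst.
  exact: ((morphism_comp (morphism_comp toV_morphism phi_morphism)
    (morphism_snd _ _)).2 e _ (regular_coord _ j)).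
have vec_morphism : morphism vec.
  apply: morphism_affine => z i.
  rewrite (_ : (fun _ => _) = fun z' : product_space (induced_space U) (affine_space k r) =>
    \sum_j (\sum_l (z'.2 : 'rV[k]_r) ord0 l * B l j) *
      ((1%:M : 'M[k]_n) j i - P (set_val z'.1) j i)); last first.
    apply/funext => z'; rewrite mxE; apply: eq_bigr => j _; rewrite mxE.
    by congr (_ * _); rewrite !mxE.
  apply: regular_sum => j; apply: regularM.
    apply: regular_sum => l; apply: regularM; last exact: regular_cst.
    exact: ((morphism_snd _ _).2 z _ (regular_coord _ l)).
  apply: regularD; first exact: regular_cst.
  rewrite (_ : (fun _ => _) = fun z' : product_space (induced_space U) (affine_space k r) =>
    -1 * P (set_val z'.1) j i); last by apply/funext => z'; rewrite mulN1r.
  apply: regularM; first exact: regular_cst.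
  exact: ((morphism_comp (morphism_fst _ _) (@morphism_val _ _ U)).2 z _
    (Preg _ _ _ (set_valP z.1 : U (set_val z.1)))).
exists psi; split.
- split; last exists chi.
    exact: morphism_pair toU_morphism psi2_morphism.
  split.
  + move=> e; do 2 apply: val_inj; rewrite /= /pt vec_psi.
    rewrite (_ : UtoV _ = (phi (toV e)).1); last first.
      by apply: val_inj; rewrite [RHS]phi_base.
    by rewrite -surjective_pairing phiK.
  + move=> z; have toV_chi : toV (chi z) = pt z by exact: val_inj.
    apply: injective_projections.
      by apply: val_inj; rewrite /= theta_base.
    by rewrite /psi /= toV_chi thetaK /= vecC.
  + do 2 apply: morphism_induced.
    have -> : set_val \o (set_val \o chi) = (set_val \o theta) \o
        (fun z => (UtoV z.1, vec z)) by [].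
    apply: morphism_comp; last exact: morphism_comp theta_morphism (morphism_val _).
    exact: morphism_pair (morphism_comp (morphism_fst _ _) UtoV_morphism) vec_morphism.
- by [].
- move=> x Ux; have [L LP] := phi_linear (UV _ Ux).
  exists (mulmxr C \o (L \o vsval)) => v e ve.
  by rewrite /psi /= (LP (vsval v))//; exact: (congr1 set_val ve).
Qed.

End Trivialisation.

Theorem proposition4 (k : closedFieldType) (char0 : [pchar k] =i pred0)
    (X : fun_space k) (varX : variety X) (connX : connected [set: X])
    (normX : normal_variety X)
    (E : fun_space k) (n : nat) (pi : linear_fibration X E)
    (bundleE : vector_bundle n pi)
    (F : set E) (closedF : closed F)
    (d : nat)
    (fibF : forall x : X, exists2 W : {vspace fibre pi x},
       fibre_at F W & \dim W = d) :
  sub_bundle pi F.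
Proof.
split=> //; pose W x := s2val (cid2 (fibF x)).
have FW x : fibre_at F (W x) by exact: (s2valP (cid2 (fibF x))).
have dimW x : \dim (W x) = d by exact: (s2valP' (cid2 (fibF x))).
exists W, FW => x0; have [_ _ triv] := bundleE.
have [V [oV Vx0 [phi [[phim [theta [phiK thetaK thetam]]] phi1 philin]]]] := triv x0.
(* Fibres of F transported to k^n; outside V the condition is empty and 0 is the default. *)
have SP x : exists S : {vspace 'rV[k]_n}, forall x' : induced_space V,
    set_val x' = x -> \dim S = d /\
    forall v : 'rV[k]_n, F (set_val (theta (x', v))) <-> v \in S.
  have [Vx|nVx] := pselect (V x); last first.
    by exists 0%VS => x' xE; case: nVx; rewrite -xE; exact: set_valP.
  have [S [dimS SE]] := fibre_image FW phiK thetaK phi1 philin (SigSub (mem_set Vx)).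
  exists S => x' xE; have -> : x' = SigSub (mem_set Vx) by exact: val_inj.
  by rewrite dimS dimW.
have [S SE] := choice SP.
have dimS x : V x -> \dim (S x) = d.
  by move=> Vx; have [] := SE x (SigSub (mem_set Vx)) erefl.
(* Closedness of F enters here: the set is the preimage of its complement under the inverse
   trivialisation. *)
have openS : open [set z : product_space (induced_space V) (affine_space k n) |
    (z.2 : 'rV[k]_n) \notin S (set_val z.1)].
  have -> : [set z : product_space (induced_space V) (affine_space k n) |
      (z.2 : 'rV[k]_n) \notin S (set_val z.1)] = (set_val \o theta) @^-1` (~` F).
    apply/funext => -[x v]; have [_ SEx] := SE _ x erefl.
    apply/propext; split=> /= [/negP vS /SEx//|nF].
    by apply/negP => /SEx.
  move/continuousP : (morphism_comp thetam (morphism_val _)).1; apply.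
  exact: closed_openC.
have [P [Preg PS]] := local_projection char0 varX normX oV Vx0 dimS openS.
pose U := (V `&` ([set y | forall i j, regular_at y (fun z => P z i j)] `&`
  [set y | [/\ P y *m P x0 = P y, P x0 *m P y = P x0 &
    forall v, (v \in S y) = (v *m P y == 0)]]))°.
have Ux0 : U x0.
  apply: nbhs_singleton; apply: nbhs_interior; apply: filterI.
    exact: open_nbhs_nbhs.
  apply: filterI PS; apply: filter_forall => i; apply: filter_forall => j.
  exact: regular_near.
exists U, (\rank (1%:M - P x0)); split=> //; first exact: open_interior.
apply: (sub_trivial FW phim phiK thetaK thetam phi1 philin (S := S)) => //.
- by move=> x v; have [] := SE _ x erefl.
- by move=> y /interior_subset[].
- by move=> y i j /interior_subset[_ [+ _]]; exact.
- by move=> y /interior_subset[_ [_]].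
Qed.
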